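(* Let $\Theta\subset\mathbb{R}^p$ be a nonempty connected open set and, for each $\theta\in\Theta$, let $f_\theta:\mathbb{R}^n\to\mathbb{R}$ be convex and $C^{1}$ with $\beta$-Lipschitz gradient and $g_\theta:\mathbb{R}^n\to\mathbb{R}\cup\{+\infty\}$ closed convex proper, where $\beta>0$ does not depend on $\theta$. Assume that either $f_\theta$ is $\alpha$-strongly convex for all $\theta$ or $g_\theta$ is $\alpha$-strongly convex for all $\theta$, with $\alpha>0$ independent of $\theta$. Let $\gamma=\frac{\alpha}{(\alpha+\beta)^2}$ and assume the maps $T(\theta,x):=\mathrm{prox}_{\gamma g_\theta}(x)$ and $(\theta,x)\mapsto\nabla f_\theta(x)$ are path differentiable jointly in $(\theta,x)\in\Theta\times\mathbb{R}^n$. Then for each $\theta\in\Theta$ the problem $\min_{x\in\mathbb{R}^n} f_\theta(x)+g_\theta(x)$ has a unique solution $x^\star(\theta)$, and $\theta\mapsto x^\star(\theta)$ is path differentiable on $\Theta$ with conservative Jacobian $$\mathcal{J}_{x^\star}(\theta)=\Big\{\big(\mathrm{Id}_n-V(\mathrm{Id}_n-\gamma Z)\big)^{-1}\big(U-\gamma VW\big)\ :\ [U\ V]\in\mathrm{Jac}^c_T\big(\theta,x^\star(\theta)-\gamma\nabla f_\theta(x^\star(\theta))\big),\ [W\ Z]\in\mathrm{Jac}^c_{\nabla f}(\theta,x^\star(\theta))\Big\},$$ where $\mathrm{Jac}^c_{\nabla f}$ is the joint Clarke Jacobian of $(\theta,x)\mapsto\nabla f_\theta(x)$.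
   Context: Clarke Jacobian: for a locally Lipschitz $f:\mathbb{R}^N\to\mathbb{R}^m$, $\mathrm{Jac}^c_f(z)=\mathrm{conv}\{\lim_k \mathrm{Jac}_f(z_k): z_k\to z,\ f \text{ differentiable at } z_k\}$. A conservative Jacobian for a locally Lipschitz $f:\mathbb{R}^N\to\mathbb{R}^m$ is a set-valued map $\mathcal{J}_f:\mathbb{R}^N\rightrightarrows\mathbb{R}^{m\times N}$ with nonempty values, locally bounded, with closed graph, such that for every absolutely continuous curve $c:[0,1]\to\mathbb{R}^N$, for almost every $t\in[0,1]$, $\frac{d}{dt}f(c(t))=M\dot c(t)$ for all $M\in\mathcal{J}_f(c(t))$. $f$ is path differentiable if it is locally Lipschitz and admits a conservative Jacobian. For $f(\theta,x)$ with $\theta\in\mathbb{R}^p$, $x\in\mathbb{R}^n$, Jacobians are written in block form $[U\ V]$ with $U$ the $\theta$-block and $V$ the $x$-block (blocks of the joint Jacobian). $\mathrm{prox}_g(x)=\mathrm{argmin}_u\, g(u)+\frac12\|x-u\|^2$. *)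

(* Defs.v *)
From HB Require Import structures.
From mathcomp Require Import all_boot all_order all_algebra.
From mathcomp Require Import all_classical all_reals all_analysis.
Set Implicit Arguments. Unset Strict Implicit. Unset Printing Implicit Defensive.
Import Order.TTheory GRing.Theory Num.Theory.
Import numFieldNormedType.Exports.
Local Open Scope classical_set_scope.
Local Open Scope ring_scope.

Section Defs.
Variable R : realType.

Definition enorm2 n (x : 'cV[R]_n) : R := \sum_(i < n) (x i ord0) ^+ 2.
Definition enorm n (x : 'cV[R]_n) : R := Num.sqrt (enorm2 x).

Definition has_jac N m (f : 'cV[R]_N -> 'cV[R]_m) (z : 'cV[R]_N) (M : 'M[R]_(m, N)) :=
  differentiable f z /\ forall v, 'd f z v = M *m v.

Definition mx_conv m N (S : set 'M[R]_(m, N)) : set 'M[R]_(m, N) :=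
  [set M | exists k (w : 'I_k -> R) (Ms : 'I_k -> 'M[R]_(m, N)),
     (forall i, 0 <= w i) /\ \sum_(i < k) w i = 1 /\ (forall i, S (Ms i)) /\
     M = \sum_(i < k) w i *: Ms i].

Definition clarke_jac N m (f : 'cV[R]_N -> 'cV[R]_m) (z : 'cV[R]_N) : set 'M[R]_(m, N) :=
  mx_conv [set M | exists (zs : nat -> 'cV[R]_N) (Js : nat -> 'M[R]_(m, N)),
     zs @ \oo --> z /\ (forall k, has_jac f (zs k) (Js k)) /\ Js @ \oo --> M].

Definition loc_lipschitz_on N m (D : set 'cV[R]_N) (f : 'cV[R]_N -> 'cV[R]_m) :=
  forall z, D z -> exists e : R, exists K : R, 0 < e /\
    forall x y, D x -> D y -> ball z e x -> ball z e y -> `|f x - f y| <= K * `|x - y|.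

Definition abs_cont_curve N (a b : R) (c : R -> 'cV[R]_N) :=
  forall e : R, 0 < e -> exists d : R, 0 < d /\
    forall k (l u : 'I_k -> R),
      (forall i, a <= l i /\ l i <= u i /\ u i <= b) ->
      (forall i j, i != j -> u i <= l j \/ u j <= l i) ->
      \sum_(i < k) (u i - l i) < d ->
      \sum_(i < k) `|c (u i) - c (l i)| < e.

Definition conservative_on N m (D : set 'cV[R]_N) (f : 'cV[R]_N -> 'cV[R]_m)
    (J : 'cV[R]_N -> set 'M[R]_(m, N)) :=
  (forall z, D z -> exists M, J z M) /\
  (forall z, D z -> exists e : R, exists K : R, 0 < e /\
     forall y M, D y -> ball z e y -> J y M -> `|M| <= K) /\
  (forall (zs : nat -> 'cV[R]_N) (Ms : nat -> 'M[R]_(m, N)) z M,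
     (forall k, D (zs k)) -> (forall k, J (zs k) (Ms k)) -> D z ->
     zs @ \oo --> z -> Ms @ \oo --> M -> J z M) /\
  (forall c : R -> 'cV[R]_N, abs_cont_curve 0 1 c ->
     (forall t, 0 <= t <= 1 -> D (c t)) ->
     {ae (@lebesgue_measure R), forall t, `[0, 1]%classic t ->
        derivable c t 1 /\ derivable (f \o c) t 1 /\
        forall M, J (c t) M -> derive1 (f \o c) t = M *m derive1 c t}).

Definition path_diff_on N m (D : set 'cV[R]_N) (f : 'cV[R]_N -> 'cV[R]_m) :=
  loc_lipschitz_on D f /\ exists J, conservative_on D f J.

Definition convex_fun n (f : 'cV[R]_n -> R) :=
  forall x y (t : R), 0 <= t <= 1 ->
    f (t *: x + (1 - t) *: y) <= t * f x + (1 - t) * f y.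

Definition strongly_convex_fun n (a : R) (f : 'cV[R]_n -> R) :=
  convex_fun (fun x => f x - a / 2 * enorm2 x).

Definition econvex_fun n (g : 'cV[R]_n -> \bar R) :=
  forall (x y : 'cV[R]_n) (t : R), 0 < t < 1 ->
    (g (t *: x + (1 - t) *: y)%R <= t%:E * g x + (1 - t)%:E * g y)%E.

Definition estrongly_convex_fun n (a : R) (g : 'cV[R]_n -> \bar R) :=
  econvex_fun (fun x => (g x - (a / 2 * enorm2 x)%:E)%E).

Definition closed_fun n (g : 'cV[R]_n -> \bar R) :=
  forall r : R, closed [set x | (g x <= r%:E)%E].

Definition proper_fun n (g : 'cV[R]_n -> \bar R) :=
  (forall x, (-oo < g x)%E) /\ exists x, (g x < +oo)%E.

Definition gradient n (f : 'cV[R]_n -> R) (x : 'cV[R]_n) : 'cV[R]_n :=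
  \col_(i < n) 'D_(delta_mx i ord0) f x.

Definition is_prox n (h : 'cV[R]_n -> \bar R) (x u : 'cV[R]_n) :=
  forall v, (h u + (enorm2 (x - u) / 2)%:E <= h v + (enorm2 (x - v) / 2)%:E)%E.

Definition joint_grad p n (F : 'cV[R]_p -> 'cV[R]_n -> R) (z : 'cV[R]_(p + n)) : 'cV[R]_n :=
  gradient (F (usubmx z)) (dsubmx z).

Definition is_minimizer n (f : 'cV[R]_n -> R) (g : 'cV[R]_n -> \bar R) (x : 'cV[R]_n) :=
  forall y, ((f x)%:E + g x <= (f y)%:E + g y)%E.

End Defs.

(* Main.v *)
Require Import Defs.
From HB Require Import structures.
From mathcomp Require Import all_boot all_order all_algebra.
From mathcomp Require Import all_classical all_reals all_analysis.
From mathcomp Require Import measurable_realfun ring lra.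
Import Order.TTheory GRing.Theory Num.Theory.
Import numFieldNormedType.Exports.
Local Open Scope classical_set_scope.
Local Open Scope ring_scope.

Set Implicit Arguments.
Unset Strict Implicit.
Unset Printing Implicit Defensive.

(* The solution is the fixed point of the forward-backward map
   [x |-> T (theta, x - gamma grad f_theta x)].  With [gamma = alpha / (alpha + beta)^2]
   this map is a contraction uniformly in [theta]: if [g] is strongly convex because
   [prox] contracts, if [f] is because the gradient step does; only monotonicity and
   the Lipschitz bound of the gradient are used.  The contraction constants pass to
   the blocks of the Clarke Jacobians, which makes [1 - V (1 - gamma Z)] invertible,
   and differentiating the fixed point equation along a curve gives the formula.

   This needs the Clarke Jacobian of a path differentiable [f] to be conservative.
   Let [J] be any conservative Jacobian of [f].  If [A v = w] for all [A] in [J z],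
   then by upper semicontinuity and a mean value inequality along segments the
   difference quotients of [f] in direction [v] near [z] are close to [w], so that
   also [M v = w] for all [M] in the Clarke Jacobian: the chain rule for [J] implies
   that for the Clarke Jacobian.  In the same way, [f] is differentiable where
   [J z] is a singleton; such points are dense by Baire's theorem, since [J y e_i]
   is a singleton at almost every point [y] of a segment in direction [e_i].  This
   replaces Rademacher's theorem. *)

(** * Matrix norms and sequences *)

(** The origin of [gamma]: if [g] has modulus [mu] and [f] has modulus [nu], the proximal and
    gradient steps multiply squared Euclidean distances by at most [a = (1 + gamma mu)^-2] and
    [b = (1 - gamma nu)^2 + (gamma beta)^2]. As [gamma (alpha + beta)^2 = alpha], both
    [gamma alpha^2] and [gamma beta^2] are below [alpha], and [a b < 1] follows for
    [(mu, nu) = (alpha, 0)] as well as for [(0, alpha)]. The obstacle is that two norms are in play.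
    The contraction holds in the Euclidean norm, whereas limits, Lipschitz constants and Jacobian
    bounds use the max norm of matrices, in which the map need not contract. [contraction_absorb]
    makes the passage at the cost of a dimensional constant, and the fixed point itself is obtained
    from an iterate of the map. The inverse in the formula is never estimated. Membership in the
    Jacobian is expressed by a linear equation [resolvent * M = rhs], whose coefficients depend
    continuously on the elements of the Clarke Jacobians, and the bound on [M] comes from absorbing
    the contracted term. *)

Section MatrixNorm.
Variable R : realType.

Lemma ler_norm_entry m n (M : 'M[R]_(m, n)) i j : `|M i j| <= `|M|.
Proof.
by rewrite [leRHS]/Num.Def.normr/= mx_normrE; exact: (le_bigmax _ _ (i, j)).
Qed.

Lemma mx_norm_leP m n (M : 'M[R]_(m, n)) r :
  0 <= r -> (forall i j, `|M i j| <= r) -> `|M| <= r.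
Proof.
move=> r0 H; rewrite [leLHS]/Num.Def.normr/= mx_normrE.
by apply: bigmax_le => // -[i j] _.
Qed.

Lemma ler_norm_mulmx m k n (A : 'M[R]_(m, k)) (B : 'M[R]_(k, n)) :
  `|A *m B| <= k%:R * (`|A| * `|B|).
Proof.
apply: mx_norm_leP => [|i j]; first by rewrite !mulr_ge0.
rewrite mxE (le_trans (ler_norm_sum _ _ _))//.
rewrite (@le_trans _ _ (\sum_(l < k) `|A| * `|B|))//; last first.
  by rewrite sumr_const card_ord mulr_natl.
by apply: ler_sum => l _; rewrite normrM ler_pM// ler_norm_entry.
Qed.

Lemma norm_col_mx_le m n k (A : 'M[R]_(m, k)) (B : 'M[R]_(n, k)) r :
  `|A| <= r -> `|B| <= r -> `|col_mx A B| <= r.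
Proof.
move=> Ar Br; apply: mx_norm_leP => [|i j]; first exact: le_trans Ar.
rewrite mxE; case: splitP => l _.
  exact: le_trans (ler_norm_entry _ _ _) Ar.
exact: le_trans (ler_norm_entry _ _ _) Br.
Qed.

Lemma norm_usubmx_le m n k (A : 'M[R]_(m + n, k)) : `|usubmx A| <= `|A|.
Proof. by apply: mx_norm_leP => // i j; rewrite mxE ler_norm_entry. Qed.

Lemma norm_dsubmx_le m n k (A : 'M[R]_(m + n, k)) : `|dsubmx A| <= `|A|.
Proof. by apply: mx_norm_leP => // i j; rewrite mxE ler_norm_entry. Qed.

Lemma norm_lsubmx_le m n k (A : 'M[R]_(k, m + n)) : `|lsubmx A| <= `|A|.
Proof. by apply: mx_norm_leP => // i j; rewrite mxE ler_norm_entry. Qed.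

Lemma norm_rsubmx_le m n k (A : 'M[R]_(k, m + n)) : `|rsubmx A| <= `|A|.
Proof. by apply: mx_norm_leP => // i j; rewrite mxE ler_norm_entry. Qed.

Lemma norm_delta_mx_le m n (i : 'I_m) (j : 'I_n) : `|delta_mx i j : 'M[R]_(m, n)| <= 1.
Proof.
by apply: mx_norm_leP => // k l; rewrite mxE; case: (_ && _); rewrite ?normr1 ?normr0.
Qed.

Lemma mulmx_colE m n (A : 'M[R]_(m, n)) i j :
  (A *m delta_mx j (ord0 : 'I_1)) i ord0 = A i j.
Proof.
rewrite mxE (bigD1 j)//= !mxE !eqxx/= mulr1 big1 ?addr0// => l lj.
by rewrite !mxE (negbTE lj) mulr0.
Qed.

Lemma mx_norm_le_mulmx m n (A : 'M[R]_(m, n)) r : 0 <= r ->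
  (forall v : 'cV_n, `|A *m v| <= r * `|v|) -> `|A| <= r.
Proof.
move=> r0 H; apply: mx_norm_leP => // i j; rewrite -mulmx_colE.
apply: le_trans (ler_norm_entry _ _ _) _; apply: le_trans (H _) _.
by rewrite ler_piMr// norm_delta_mx_le.
Qed.

Lemma mulmx_ext m n (A B : 'M[R]_(m, n)) :
  (forall j, A *m delta_mx j (ord0 : 'I_1) = B *m delta_mx j ord0) -> A = B.
Proof. by move=> H; apply/matrixP => i j; rewrite -(mulmx_colE A) H mulmx_colE. Qed.

End MatrixNorm.

Section Sequences.
Variable R : realType.

Lemma cvg_seqP (V : normedModType R) (u : nat -> V) (l : V) :
  u @ \oo --> l <->
  forall e, 0 < e -> exists N, forall k, (N <= k)%N -> `|u k - l| <= e.
Proof.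
split=> [/cvgrPdist_le H e e0|H].
  by have [N _ HN] := H e e0; exists N => k Nk; rewrite distrC HN.
apply/cvgrPdist_le => e e0; have [N HN] := H e e0.
by exists N => // k /= Nk; rewrite distrC HN.
Qed.

Lemma cvg_mxP m n (u : nat -> 'M[R]_(m, n)) (l : 'M[R]_(m, n)) :
  u @ \oo --> l <-> forall i j, (fun k => u k i j) @ \oo --> l i j.
Proof.
split=> [H i j|H].
  apply/cvg_seqP => e e0; have /cvg_seqP/(_ e e0)[N HN] := H.
  exists N => k /HN; apply: le_trans.
  by have := ler_norm_entry (u k - l) i j; rewrite !mxE.
apply/cvgrPdist_le => e e0.
have H1 (ij : 'I_m * 'I_n) :
    \forall k \near \oo, `|l ij.1 ij.2 - u k ij.1 ij.2| <= e.
  by have /cvgrPdist_le/(_ e e0) := H ij.1 ij.2.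
have : \forall k \near \oo, forall ij : 'I_m * 'I_n,
    `|l ij.1 ij.2 - u k ij.1 ij.2| <= e by exact: filter_forall.
apply: filterS => k Hk.
apply: mx_norm_leP => [|i j]; first exact: ltW.
by have := Hk (i, j); rewrite !mxE.
Qed.

Lemma cvg_sum_fin (V : normedModType R) (I : finType) (u : I -> nat -> V) (l : I -> V) :
  (forall i, u i @ \oo --> l i) ->
  (fun k => \sum_i u i k) @ \oo --> \sum_i l i.
Proof. by move=> H; apply: cvg_big => //; exact: add_continuous. Qed.

Lemma cvg_mulmx m n k (A : nat -> 'M[R]_(m, n)) (B : nat -> 'M[R]_(n, k)) (a : 'M[R]_(m, n)) (b : 'M[R]_(n, k)) :
  A @ \oo --> a -> B @ \oo --> b -> (fun i => A i *m B i) @ \oo --> a *m b.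
Proof.
move=> /cvg_mxP HA /cvg_mxP HB; apply/cvg_mxP => i j.
rewrite mxE (_ : (fun _ => _) = (fun l => \sum_k A l i k * B l k j)); last first.
  by apply/funext => l; rewrite mxE.
by apply: cvg_sum_fin => l; apply: cvgM.
Qed.

Lemma cvg_mx_entries m n m' n' (u : nat -> 'M[R]_(m, n)) (l : 'M[R]_(m, n))
    (g : 'M[R]_(m, n) -> 'M[R]_(m', n')) (f : 'I_m' -> 'I_n' -> 'I_m * 'I_n) :
  (forall M i j, g M i j = M (f i j).1 (f i j).2) ->
  u @ \oo --> l -> (fun k => g (u k)) @ \oo --> g l.
Proof.
move=> gE /cvg_mxP H; apply/cvg_mxP => i j.
by under eq_fun do rewrite gE; rewrite gE; exact: H.
Qed.

Lemma cvg_lsubmx m n k (u : nat -> 'M[R]_(k, m + n)) (l : 'M[R]_(k, m + n)) :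
  u @ \oo --> l -> (fun i => lsubmx (u i)) @ \oo --> lsubmx l.
Proof.
apply: (@cvg_mx_entries _ _ _ _ _ _ _ (fun i j => (i, lshift _ j))) => M i j.
by rewrite mxE.
Qed.

Lemma cvg_rsubmx m n k (u : nat -> 'M[R]_(k, m + n)) (l : 'M[R]_(k, m + n)) :
  u @ \oo --> l -> (fun i => rsubmx (u i)) @ \oo --> rsubmx l.
Proof.
apply: (@cvg_mx_entries _ _ _ _ _ _ _ (fun i j => (i, rshift _ j))) => M i j.
by rewrite mxE.
Qed.

Lemma cvg_col_mx m n k (u : nat -> 'M[R]_(m, k)) (v : nat -> 'M[R]_(n, k)) (a : 'M[R]_(m, k)) (b : 'M[R]_(n, k)) :
  u @ \oo --> a -> v @ \oo --> b ->
  (fun i => col_mx (u i) (v i)) @ \oo --> col_mx a b.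
Proof.
move=> /cvg_mxP Ha /cvg_mxP Hb; apply/cvg_mxP => i j; rewrite mxE.
rewrite (_ : (fun _ => _) = (fun l => match fintype.split i with
  | inl i1 => u l i1 j | inr i2 => v l i2 j end)); last first.
  by apply/funext => l; rewrite mxE.
by case: splitP => l _.
Qed.

Lemma cvg_subseq (V : normedModType R) (u : nat -> V) (l : V) (f : nat -> nat) : increasing_seq f ->
  u @ \oo --> l -> (u \o f) @ \oo --> l.
Proof.
move=> fi ul; apply: cvg_comp ul.
move=> A [N _ NA]; exists N => // k /= Nk; apply: NA => /=.
rewrite (leq_trans Nk)//; elim: k {Nk} => // k /leq_ltn_trans; apply.
by move/increasing_seqP: fi; exact.
Qed.

Lemma increasing_seq_id : increasing_seq (id : nat -> nat).
Proof. by apply/increasing_seqP => n; exact: ltnSn. Qed.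

Lemma increasing_seq_comp (f g : nat -> nat) :
  increasing_seq f -> increasing_seq g -> increasing_seq (f \o g).
Proof. by move=> fi gi a b; exact: etrans (fi _ _) (gi _ _). Qed.

Lemma bounded_family_subseq (I : finType) (u : nat -> I -> R) K :
  (forall k i, `|u k i| <= K) ->
  exists f : nat -> nat, increasing_seq f /\
    exists l : I -> R, forall i, (fun k => u (f k) i) @ \oo --> l i.
Proof.
move=> uK.
(* Coordinates are treated one after the other along an enumeration; a further subsequence keeps the
   limits already obtained. *)
suff H (s : seq I) : exists f : nat -> nat, increasing_seq f /\
    forall i, i \in s -> cvgn (fun k => u (f k) i).
  have [f [fi fc]] := H (enum I); exists f; split => //.
  exists (fun i => lim ((fun k => u (f k) i) @ \oo)) => i.
  by apply: fc; rewrite mem_enum.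
elim: s => [|a s [f [fi IH]]]; first by exists id; split=> //; exact: increasing_seq_id.
have [|g gi gc] := @bolzano_weierstrass R (fun k => u (f k) a).
  exists K; split; first exact: num_real.
  by move=> x Kx k _; exact: le_trans (uK (f k) a) (ltW Kx).
exists (f \o g); split; first exact: increasing_seq_comp.
move=> i; rewrite inE => /orP[/eqP->//|/IH].
move=> /cvg_ex[l Hl]; apply/cvg_ex; exists l.
exact: (cvg_subseq gi Hl).
Qed.

Lemma bounded_mx_subseq m n (u : nat -> 'M[R]_(m, n)) K :
  (forall k, `|u k| <= K) ->
  exists f : nat -> nat, increasing_seq f /\
    exists l : 'M[R]_(m, n), (u \o f) @ \oo --> l.
Proof.
move=> uK.
have [|f [fi [l Hl]]] :=
  @bounded_family_subseq _ (fun k (ij : 'I_m * 'I_n) => u k ij.1 ij.2) K.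
  by move=> k ij; exact: le_trans (ler_norm_entry _ _ _) (uK k).
exists f; split => //; exists (\matrix_(i, j) l (i, j)).
by apply/cvg_mxP => i j; rewrite mxE; exact: (Hl (i, j)).
Qed.

Lemma cvg_norm_le (V : normedModType R) (u : nat -> V) (l : V) K k0 :
  u @ \oo --> l -> (forall k, (k0 <= k)%N -> `|u k| <= K) -> `|l| <= K.
Proof.
move=> /cvg_norm ul uK; rewrite -(cvg_lim _ ul)//.
apply: limr_le; first by apply/cvg_ex; exists `|l|.
by exists k0.
Qed.

Lemma cvg_unique_seq (V : normedModType R) (u : nat -> V) (l : V) l' :
  u @ \oo --> l -> u @ \oo --> l' -> l = l'.
Proof. by move=> H H'; exact: (cvg_unique (@norm_hausdorff _ _) H H'). Qed.

(** Countable choice at the radii [1 / (k + 1)]; the second component carries a witness attached to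
    the point, such as a Jacobian. *)
Lemma exists_seq_cvg (V : normedModType R) (W : Type) (P : V -> W -> Prop) z :
  (forall e, 0 < e -> exists y a, `|y - z| <= e /\ P y a) ->
  exists (u : nat -> V) (a : nat -> W), u @ \oo --> z /\ forall k, P (u k) (a k).
Proof.
move=> H; have /choice [u Hu] : forall k : nat, exists ya : V * W,
    `|ya.1 - z| <= k.+1%:R^-1 /\ P ya.1 ya.2.
  move=> k; have [|y [a Ha]] := H k.+1%:R^-1; first by rewrite invr_gt0.
  by exists (y, a).
exists (fun k => (u k).1), (fun k => (u k).2).
split; last by move=> k; case: (Hu k).
apply/cvg_seqP => e e0; exists (Num.truncn e^-1) => k Nk.
have [+ _] := Hu k; move=> /le_trans; apply.
rewrite invf_ple ?posrE//; apply: ltW.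
by apply: (lt_le_trans (Num.Theory.truncnS_gt _)); rewrite ler_nat.
Qed.

End Sequences.

(** * Derivatives and the mean value inequality *)

Section Calculus.
Variable R : realType.

Lemma nbhs_epsP (V : normedModType R) (x : V) (P : set V) :
  nbhs x P <-> exists e : R, 0 < e /\ forall y, `|y - x| < e -> P y.
Proof.
split=> [/nbhs_ballP[e e0 He]|[e [e0 He]]].
  by exists e; split => // y xy; apply: He; rewrite -ball_normE/= distrC.
by apply/nbhs_ballP; exists e => // y; rewrite -ball_normE/= distrC; exact: He.
Qed.

(** The remainder form avoids the quotient and admits [h = 0], so that estimates combine by the
    triangle inequality. *)
Lemma derivable_epsP (V W : normedModType R) (f : V -> W) x v w :
  (derivable f x v /\ 'D_v f x = w) <->
  forall e, 0 < e -> exists d, 0 < d /\ forall h : R, `|h| < d ->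
    `|f (x + h *: v) - f x - h *: w| <= e * `|h|.
Proof.
have quotE (h : R) : h != 0 ->
    `|f (x + h *: v) - f x - h *: w| =
    `|h| * `|w - h^-1 *: (f (h *: v + x) - f x)|.
  move=> h0; rewrite -normrZ scalerBr scalerA divff// scale1r.
  by rewrite -normrN opprB [x + _]addrC.
split=> [[df dw] e e0|H].
  have : h^-1 *: (f (h *: v + x) - f x) @[h --> 0^'] --> w by rewrite -dw.
  move/cvgrPdist_le/(_ e e0) => [d d0 Hd]; exists d; split => // h hd.
  have [->|h0] := eqVneq h 0.
    by rewrite !scale0r addr0 subrr subr0 !normr0 mulr0.
  rewrite quotE// mulrC ler_wpM2r//.
  by apply: (Hd h) => //=; rewrite sub0r normrN.
have C : h^-1 *: (f (h *: v + x) - f x) @[h --> 0^'] --> w.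
  apply/cvgrPdist_le => e e0; have [d [d0 Hd]] := H e e0.
  exists d => // h /=; rewrite sub0r normrN => hd h0.
  by have := Hd h hd; rewrite quotE// mulrC ler_pM2r// normr_gt0.
split; first by apply/cvg_ex; exists w.
exact: (cvg_lim _ C).
Qed.

Lemma derivable1_epsP (W : normedModType R) (f : R -> W) x w :
  (derivable f x 1 /\ derive1 f x = w) <->
  forall e, 0 < e -> exists d, 0 < d /\ forall h : R, `|h| < d ->
    `|f (x + h) - f x - h *: w| <= e * `|h|.
Proof.
rewrite derive1E derivable_epsP.
by split=> H e /H[d [d0 Hd]]; exists d; split => // h /Hd; rewrite [_%:A]mulr1.
Qed.

Lemma mulmx_continuous m N (M : 'M[R]_(m, N)) :
  continuous (mulmx M : 'cV[R]_N -> 'cV[R]_m).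
Proof.
move=> x; have FF : Filter (nbhs x) by exact: nbhs_filter.
apply/cvgrPdist_le => e e0.
pose C := N%:R * `|M| + 1.
have C0 : 0 < C by rewrite ltr_wpDl// mulr_ge0.
apply/(@nbhs_epsP 'cV[R]_N); exists (e / C); split; first by rewrite divr_gt0.
move=> y; rewrite distrC => xy.
rewrite -mulmxBr (le_trans (ler_norm_mulmx _ _))// mulrA.
rewrite (@le_trans _ _ (C * `|x - y|))//; first by rewrite ler_wpM2r// lerDl.
by rewrite mulrC -ler_pdivlMr// ltW.
Qed.

Lemma has_jac_epsP N m (f : 'cV[R]_N -> 'cV[R]_m) z M :
  has_jac f z M <->
  forall e, 0 < e -> exists d, 0 < d /\ forall v, `|v| < d ->
    `|f (z + v) - f z - M *m v| <= e * `|v|.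
Proof.
split=> [[df dM] e e0|H].
  have /eqaddoP/(_ e e0)/(@nbhs_epsP 'cV[R]_N) [d [d0 Hd]] := diff_locally df.
  exists d; split => // v vd.
  have /= := Hd v; rewrite subr0 => /(_ vd).
  by rewrite !fctE dM opprD addrA [v + z]addrC.
have E : f \o shift z = cst (f z) + mulmx M +o_ (0 : 'cV[R]_N) id.
  apply/eqaddoP => e e0; have [d [d0 Hd]] := H e e0.
  apply/(@nbhs_epsP 'cV[R]_N); exists d; split => // v; rewrite subr0 => /Hd.
  by rewrite !fctE/= opprD addrA [z + v]addrC.
have dE := diff_unique (@mulmx_continuous _ _ M) E.
split; last by move=> v; rewrite dE.
apply/diff_locallyP; rewrite dE; split => //; exact: mulmx_continuous.
Qed.

(* A Lipschitz function whose upper right Dini derivative is almost everywhere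
   at most [e] grows at rate at most [e]: cover the exceptional null set by an
   open set [O] of small measure and compare [h x] with [e * x] plus a multiple
   of the measure of [O] in [[0, x]]. *)
Lemma ae_mean_value (h : R -> R) (K e : R) : 0 <= e ->
  (forall x y, 0 <= x <= 1 -> 0 <= y <= 1 -> `|h x - h y| <= K * `|x - y|) ->
  {ae (@lebesgue_measure R), forall t, `[0, 1]%classic t ->
     forall eta, 0 < eta -> exists d, 0 < d /\ forall s, 0 < s < d ->
       h (t + s) - h t <= (e + eta) * s} ->
  h 1 - h 0 <= e.
Proof.
move=> e0 hK [B [mB B0 BP]].
wlog K0 : K hK / 0 < K.
  move=> W; apply: (W (`|K| + 1)); last by rewrite ltr_wpDl.
  move=> x y x01 y01; apply: le_trans (hK _ _ x01 y01) _.
  by rewrite ler_wpM2r// (le_trans (ler_norm _))// lerDl.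
apply/ler_addgt0Pr => eps eps0.
(* The error [eps] is shared equally: [eta] costs at most [eps / 2] over the unit interval, and
   [K * delta = eps / 2] pays for the exceptional set. *)
pose eta := eps / 2; pose delta := eps / 2 / K.
have eta0 : 0 < eta by rewrite divr_gt0.
have delta0 : 0 < delta by rewrite !divr_gt0.
have [|O [Oo BO OB]] := @lebesgue_regularity_outer R B delta mB _ delta0.
  rewrite [X in (X < _)%E](_ : _ = 0%E); [exact: ltry|exact: B0].
have mO : measurable O by exact: open_measurable.
have Od : (lebesgue_measure O < delta%:E)%E.
  apply: le_lt_trans OB; rewrite -{1}(setDUK BO).
  rewrite (le_trans (measureU2 _ _ _))//; first exact: measurableD.
  rewrite [X in (X + _)%E](_ : _ = 0%E) ?add0e//; exact: B0.
have mu_le (A C : set R) : measurable A -> measurable C -> A `<=` C ->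
    (lebesgue_measure A <= lebesgue_measure C)%E.
  move=> mA mC AC; apply: le_measure => //; rewrite inE; [exact: mA|exact: mC].
have mI a b : measurable (O `&` `[a, b]%classic) by exact: measurableI.
have fI a b : (lebesgue_measure (O `&` `[a, b]%classic) < delta%:E)%E.
  by apply: le_lt_trans Od; apply: mu_le => //; exact: subIsetl.
have finI a b : lebesgue_measure (O `&` `[a, b]%classic) \is a fin_num.
  by rewrite ge0_fin_numE//; apply: lt_trans (fI a b) _; rewrite ltry.
pose phi x := fine (lebesgue_measure (O `&` `[0, x]%classic)).
have phi_le x y : x <= y -> phi x <= phi y.
  move=> xy; apply: fine_le => //; apply: mu_le => //.
  apply: setIS => z /=; rewrite !in_itv/= => /andP[-> zx].
  exact: le_trans zx xy.
have phi_O x y : 0 <= x -> x <= y -> `]x, y]%classic `<=` O ->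
    phi x + (y - x) <= phi y.
  move=> x0 xy xyO.
  have muxy : lebesgue_measure `]x, y]%classic = (y - x)%:E.
    rewrite lebesgue_measure_itv/= lte_fin; case: ltP => // yx.
    by congr (_%:E); apply/esym/eqP; rewrite subr_eq0 eq_le yx xy.
  have D : (O `&` `[0, x]%classic) `&` `]x, y]%classic = set0.
    rewrite -subset0 => z [[_ /=]]; rewrite !in_itv => /andP[_ zx] /andP[xz _].
    by have := lt_le_trans xz zx; rewrite ltxx.
  have mxy : measurable (`]x, y]%classic : set R) by exact: measurable_itv.
  have U := measureU (@lebesgue_measure R) (mI 0 x) mxy D.
  have : (lebesgue_measure ((O `&` `[0%R, x]%classic) `|` `]x, y]%classic) <=
      lebesgue_measure (O `&` `[0%R, y]%classic))%E.
    apply: mu_le => //; first exact: measurableU.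
    move=> z [[Oz]|zxy].
      move=> /=; rewrite !in_itv/= => /andP[z0 zx].
      by split => //=; rewrite z0 (le_trans zx).
    split; first exact: xyO.
    move: zxy; rewrite /= !in_itv/= => /andP[xz ->].
    by rewrite (le_trans x0 (ltW xz)).
  rewrite [X in (X <= _)%E]U [X in (_ + X <= _)%E]muxy => H.
  rewrite /phi -lee_fin [leLHS]EFinD (fineK (finI 0 x)) (fineK (finI 0 y)); exact: H.
have phi1 : phi 1 <= delta by rewrite /phi -lee_fin (fineK (finI 0 1)); exact: ltW (fI 0 1).
have phi0 : 0 <= phi 0 by exact: fine_ge0.
(* [A] contains its supremum because [h] is Lipschitz; what remains is to step beyond [sup A] when
   it is less than 1. *)
pose A := [set x | 0 <= x <= 1 /\ h x - h 0 <= (e + eta) * x + K * phi x].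
have A0 : A 0.
  by split; rewrite ?lexx ?ler01// subrr mulr0 add0r mulr_ge0// ltW.
have supA : has_sup A.
  by split; [exists 0|exists 1 => x [/andP[_ ]]].
pose s := sup A.
have s0 : 0 <= s by apply: ub_le_sup A0; case: supA.
have s1 : s <= 1 by apply: ge_sup; [exists 0|move=> x [/andP[_ ]]].
have s01 : 0 <= s <= 1 by rewrite s0.
have As : A s.
  split => //; apply/ler_addgt0Pr => r r0.
  have [x [x01 Ax] sx] := sup_adherent (divr_gt0 r0 K0) supA.
  have xs : x <= s by apply: ub_le_sup => //; case: supA.
  have h1 := hK s x s01 x01.
  have h2 : h s - h x <= K * (s - x).
    apply: le_trans (ler_norm _) (le_trans h1 _).
    by rewrite ger0_norm ?subr_ge0.
  have h3 : K * (s - x) <= r.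
    by rewrite mulrC -ler_pdivlMr// lerBlDl -lerBlDr ltW.
  have h4 : (e + eta) * x <= (e + eta) * s.
    by rewrite ler_wpM2l// addr_ge0// ltW.
  have h5 : K * phi x <= K * phi s by rewrite ler_wpM2l ?phi_le// ltW.
  lra.
have [s1'|s_lt1] := leP 1 s; last first.
  exfalso.
  suff [y [sy y1 Ay]] : exists y, [/\ s < y, y <= 1 &
      h y - h s <= (e + eta) * (y - s) + K * (phi y - phi s)].
    have : A y.
      split; first by rewrite y1 (le_trans s0 (ltW sy)).
      by case: As => _ ?; lra.
    move=> /(ub_le_sup (proj2 supA)); rewrite leNgt => /negP; exact.
  (* At an exceptional point an interval to the right lies in [O], where [phi] has slope one and
     [K * phi] outweighs the Lipschitz growth of [h]; elsewhere the Dini bound applies. *)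
  have [Bs|nBs] := pselect (B s).
    have /(@nbhs_epsP R) [r [r0 Hr]] : nbhs s O.
      by apply: open_nbhs_nbhs; split => //; exact: BO.
    pose y := s + Num.min (r / 2) (1 - s).
    have m0 : 0 < Num.min (r / 2) (1 - s) by rewrite lt_min divr_gt0//= subr_gt0.
    have mr : Num.min (r / 2) (1 - s) <= r / 2 by rewrite ge_min lexx.
    have m1 : Num.min (r / 2) (1 - s) <= 1 - s by rewrite ge_min lexx orbT.
    have sy : s < y by rewrite /y ltrDl.
    have y1 : y <= 1 by rewrite /y; lra.
    exists y; split => //.
    have yO : `]s, y]%classic `<=` O.
      move=> z /=; rewrite in_itv/= => /andP[sz zy]; apply: Hr.
      rewrite gtr0_norm ?subr_gt0//; move: zy; rewrite /y; lra.
    have p1 := phi_O s y s0 (ltW sy) yO.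
    have y01 : 0 <= y <= 1 by rewrite y1 (le_trans s0 (ltW sy)).
    have h1 := le_trans (ler_norm _) (hK y s y01 s01).
    rewrite gtr0_norm ?subr_gt0// in h1.
    have h2 : K * (y - s) <= K * (phi y - phi s).
      by apply: ler_wpM2l; [exact: ltW|lra].
    have h3 : 0 <= (e + eta) * (y - s).
      by apply: mulr_ge0; [apply: addr_ge0 => //; exact: ltW|rewrite subr_ge0 ltW].
    lra.
  have Q : forall eta, 0 < eta ->
      exists d, 0 < d /\ forall s', 0 < s' < d -> h (s + s') - h s <= (e + eta) * s'.
    apply: contrapT => nQ; apply: nBs; apply: BP => /= H; apply: nQ.
    by move=> r r0; apply: (H _ r r0); rewrite in_itv.
  have [d [d0 Hd]] := Q eta eta0.
  pose m := Num.min (d / 2) (1 - s).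
  have m0 : 0 < m by rewrite lt_min divr_gt0//= subr_gt0.
  have mr : m <= d / 2 by rewrite ge_min lexx.
  have m1 : m <= 1 - s by rewrite ge_min lexx orbT.
  exists (s + m); split; [by rewrite ltrDl|by rewrite -lerBrDl|].
  have md : 0 < m < d by rewrite m0/= (le_lt_trans mr)//; lra.
  have := Hd m md.
  have : 0 <= K * (phi (s + m) - phi s).
    by rewrite mulr_ge0 ?(ltW K0)// subr_ge0 phi_le// ler_wpDr// ltW.
  rewrite [s + m - s]addrAC subrr add0r; lra.
have sE : s = 1 by apply/eqP; rewrite eq_le s1 s1'.
have [_] := As; rewrite sE.
have : K * phi 1 <= K * delta by rewrite ler_wpM2l// ltW.
have -> : K * delta = eps / 2 by rewrite /delta mulrC divfK// gt_eqF.
rewrite /eta; lra.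
Qed.

End Calculus.

(** * Conservative Jacobians *)

Section Line.
Variable R : realType.

Lemma line_abs_cont N (x v : 'cV[R]_N) : abs_cont_curve 0 1 (fun s : R => x + s *: v).
Proof.
move=> e e0; have K0 : 0 < `|v| + 1 by rewrite ltr_wpDl.
exists (e / (`|v| + 1)); split; first by rewrite divr_gt0.
move=> k l u lu _; rewrite ltr_pdivlMr// => /le_lt_trans-> //.
rewrite mulr_suml; apply: ler_sum => i _.
have [_ [li _]] := lu i.
rewrite opprD addrACA subrr add0r -scalerBl normrZ ger0_norm ?subr_ge0//.
by rewrite ler_wpM2l ?subr_ge0// lerDl.
Qed.

Lemma line_derive1 N (x v : 'cV[R]_N) t : derive1 (fun s : R => x + s *: v) t = v.
Proof.
have [_ ->//] : derivable (fun s : R => x + s *: v) t 1 /\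
    derive1 (fun s : R => x + s *: v) t = v.
apply/derivable1_epsP => e e0; exists 1; split => // h _.
rewrite scalerDl opprD !addrA [x + _ + _]addrAC -addrA addrC !addrA.
by rewrite [X in `|X|](_ : _ = 0) ?normr0 ?mulr_ge0// ?(ltW e0)//;
  apply/matrixP => i j; rewrite !mxE; ring.
Qed.

Lemma ae_unit_interval (P : R -> Prop) :
  {ae (@lebesgue_measure R), forall t, `[0, 1]%classic t -> P t} ->
  exists t, 0 <= t <= 1 /\ P t.
Proof.
move=> [B [mB B0 BP]]; apply: contrapT => nP.
have sub : `[0, 1]%classic `<=` B.
  move=> t t01; apply: BP => /= H; apply: nP; exists t; split; last exact: H.
  by move: t01; rewrite /= in_itv.
have : (lebesgue_measure (`[0%R, 1%R]%classic : set R) <= lebesgue_measure B)%E.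
  apply: le_measure => //; rewrite inE; [exact: measurable_itv|exact: mB].
rewrite [X in (_ <= X)%E -> _](_ : _ = 0%E); last exact: B0.
by rewrite lebesgue_measure_itv/= lte_fin ltr01 oppr0 adde0 lee_fin ler10.
Qed.

End Line.

Section LocalConstants.
Variables (R : realType) (N m : nat) (D : set 'cV[R]_N).
Hypothesis openD : open D.

Lemma open_ball_sub z : D z -> exists r : R, 0 < r /\ forall y, `|y - z| < r -> D y.
Proof. by move=> Dz; apply/(@nbhs_epsP R 'cV[R]_N); exact: open_nbhs_nbhs. Qed.

Lemma loc_lipschitz_ball (f : 'cV[R]_N -> 'cV[R]_m) z :
  loc_lipschitz_on D f -> D z ->
  exists r K : R, [/\ 0 < r, 0 <= K, forall y, `|y - z| < r -> D y &
    forall x y, `|x - z| < r -> `|y - z| < r -> `|f x - f y| <= K * `|x - y|].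
Proof.
move=> lf Dz; have [r [r0 Hr]] := open_ball_sub Dz.
have [e [K [e0 He]]] := lf z Dz.
exists (Num.min r e), `|K|; split => //; first by rewrite lt_min r0.
  by move=> y; rewrite lt_min => /andP[/Hr].
move=> x y; rewrite !lt_min => /andP[xr xe] /andP[yr ye].
apply: le_trans (He x y (Hr _ xr) (Hr _ yr) _ _) _.
- by rewrite -ball_normE/= distrC.
- by rewrite -ball_normE/= distrC.
- by rewrite ler_wpM2r// ler_norm.
Qed.

Lemma loc_lipschitz_cvg (f : 'cV[R]_N -> 'cV[R]_m) z (u : nat -> 'cV[R]_N) :
  loc_lipschitz_on D f -> D z -> u @ \oo --> z -> (fun k => f (u k)) @ \oo --> f z.
Proof.
move=> lf Dz /cvg_seqP uz; have [r [K [r0 K0 _ HK]]] := loc_lipschitz_ball lf Dz.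
apply/cvg_seqP => e e0.
have K1 : 0 < K + 1 by rewrite ltr_wpDl.
have [|k0 Hk] := uz (Num.min (r / 2) (e / (K + 1))).
  by rewrite lt_min !divr_gt0.
exists k0 => k /Hk; rewrite le_min => /andP[kr].
rewrite ler_pdivlMr// => ke.
apply: le_trans (HK _ _ _ _) _; last 1 first.
- apply: le_trans ke; rewrite mulrC ler_wpM2l// lerDl//.
- by apply: le_lt_trans kr _; rewrite ltr_pdivrMr// ltr_pMr// ltr1n.
- by rewrite subrr normr0.
Qed.

End LocalConstants.

Section Conservative.
Variables (R : realType) (N m : nat) (D : set 'cV[R]_N).
Variables (f : 'cV[R]_N -> 'cV[R]_m) (J : 'cV[R]_N -> set 'M[R]_(m, N)).
Hypotheses (openD : open D) (lipf : loc_lipschitz_on D f).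
Hypothesis consJ : conservative_on D f J.

(** Each coordinate of [f (x + s *: v) - s *: w], with either sign, has derivative at most [e] at
    almost every [s], because conservativity makes [A *m v] the derivative of [f] along the segment
    for any [A] in [J]. The constant [L] provides the regularity for [ae_mean_value] without
    entering the bound. *)
Lemma conservative_mean_value x v w e L : 0 <= e ->
  (forall s : R, 0 <= s <= 1 -> D (x + s *: v)) ->
  (forall s t : R, 0 <= s <= 1 -> 0 <= t <= 1 ->
     `|f (x + s *: v) - f (x + t *: v)| <= L * `|s - t|) ->
  (forall (s : R) A, 0 <= s <= 1 -> J (x + s *: v) A -> `|A *m v - w| <= e) ->
  `|f (x + v) - f x - w| <= e.
Proof.
move=> e0 DS LS JS; have [Jne [_ [_ Jc]]] := consJ.
have ae := Jc _ (line_abs_cont x v) DS.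
apply: mx_norm_leP => // i j; rewrite ord1 {j}.
pose g s := f (x + s *: v) i ord0 - s * w i ord0.
suff H (b : R) : `|b| = 1 -> b * (g 1 - g 0) <= e.
  have gE : g 1 - g 0 = (f (x + v) - f x - w) i ord0.
    by rewrite /g scale1r scale0r addr0 !mxE; ring.
  rewrite -gE ler_norml.
  have h1 := H 1 (normr1 _); have h2 := H (-1) (normrN1 _).
  by apply/andP; split; lra.
move=> b1; rewrite mulrBr.
apply: (@ae_mean_value _ (fun s => b * g s) (L + `|w i ord0|)) => //.
  move=> s t s01 t01; rewrite -mulrBr normrM b1 mul1r.
  have -> : g s - g t = (f (x + s *: v) - f (x + t *: v)) i ord0 - (s - t) * w i ord0.
    by rewrite /g !mxE; ring.
  rewrite (le_trans (ler_normB _ _))// [leRHS]mulrDl lerD//.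
    exact: le_trans (ler_norm_entry _ _ _) (LS _ _ s01 t01).
  by rewrite normrM mulrC.
have [B [mB B0 BP]] := ae; exists B; split => // t' nt; apply: BP => Ht.
apply: nt => /=; move: t' Ht => t Ht t01 eta eta0.
have [_ [df HA]] := Ht t01.
have t01' : 0 <= t <= 1 by move: t01; rewrite /= in_itv.
have [A JA] := Jne _ (DS t t01').
have dE := HA A JA; rewrite line_derive1 in dE.
have /derivable1_epsP/(_ eta eta0)[d [d0 Hd]] := conj df dE.
exists d; split => // s /andP[s0 sd].
have := Hd s; rewrite gtr0_norm// => /(_ sd) /= h1.
rewrite -mulrBr (le_trans (ler_norm _))// normrM b1 mul1r.
have -> : g (t + s) - g t =
   (f (x + (t + s) *: v) - f (x + t *: v) - s *: (A *m v)) i ord0 +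
   s * (A *m v - w) i ord0.
  by rewrite /g !mxE; ring.
rewrite (le_trans (ler_normD _ _))// [leLHS]addrC [leRHS]mulrDl lerD//.
  rewrite normrM gtr0_norm// mulrC ler_wpM2r ?(ltW s0)//.
  exact: le_trans (ler_norm_entry _ _ _) (JS _ _ t01' JA).
exact: le_trans (ler_norm_entry _ _ _) h1.
Qed.

(** Otherwise matrices violating [Q] occur at points tending to [z]; being bounded they have a limit
    point, which lies in [J z] by the closed graph and still violates [Q], whose complement is
    sequentially closed. *)
Lemma conservative_usc (Q : 'M[R]_(m, N) -> Prop) z : D z ->
  (forall (As : nat -> 'M[R]_(m, N)) (A : 'M[R]_(m, N)),
     As @ \oo --> A -> (forall k, ~ Q (As k)) -> ~ Q A) ->
  (forall A, J z A -> Q A) ->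
  exists r : R, 0 < r /\ forall y A, `|y - z| < r -> D y -> J y A -> Q A.
Proof.
move=> Dz Qc JQ; apply: contrapT => H; have [_ [Jb [Jg _]]] := consJ.
have [r [K [r0 HK]]] := Jb z Dz.
have [|u [As [uz Hu]]] := @exists_seq_cvg R 'cV[R]_N 'M[R]_(m, N)
    (fun y A => [/\ D y, J y A, ~ Q A & `|A| <= K]) z.
  move=> e e0; apply: contrapT => nH; apply: H.
  exists (Num.min e r); split; first by rewrite lt_min e0.
  move=> y A; rewrite lt_min => /andP[ye yr] Dy JyA.
  apply: contrapT => nQ; apply: nH; exists y, A; split; first exact: ltW.
  split => //; apply: HK JyA => //.
  by rewrite -ball_normE/= distrC.
have [|s [si [A Al]]] := @bounded_mx_subseq R _ _ As K.
  by move=> k; case: (Hu k).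
apply: (Qc (As \o s) A Al); first by move=> k /=; case: (Hu (s k)).
apply: JQ; apply: (Jg (u \o s) (As \o s)) => //.
- by move=> k; case: (Hu (s k)).
- by move=> k; case: (Hu (s k)).
- exact: (cvg_subseq si uz).
Qed.

(** The width [p] is free so that [v] can be a direction or the identity, the latter giving a
    condition on the whole matrix. *)
Lemma far_closed p (v : 'M[R]_(N, p)) w (e : R) :
  forall (As : nat -> 'M[R]_(m, N)) (A : 'M[R]_(m, N)),
     As @ \oo --> A -> (forall k, ~ (`|As k *m v - w| < e)) -> ~ (`|A *m v - w| < e).
Proof.
move=> As A AsA H; apply/negP; rewrite -leNgt.
have C : (fun k => `|As k *m v - w|) @ \oo --> `|A *m v - w|.
  apply: cvg_norm; apply: cvgB; last exact: cvg_cst.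
  by apply: cvg_mulmx => //; exact: cvg_cst.
rewrite -(cvg_lim _ C)//; apply: limr_ge; first by apply/cvg_ex; eexists; exact: C.
by apply: nearW => k; rewrite leNgt; apply/negP.
Qed.

Lemma conservative_usc_dir z (v : 'cV[R]_N) (w : 'cV[R]_m) e : D z -> 0 < e ->
  (forall A, J z A -> A *m v = w) ->
  exists r : R, 0 < r /\ forall y A, `|y - z| < r -> D y -> J y A -> `|A *m v - w| < e.
Proof.
move=> Dz e0 H; apply: (@conservative_usc (fun A => `|A *m v - w| < e)) => //.
  exact: far_closed.
by move=> A /H ->; rewrite subrr normr0.
Qed.

(** For small [t], the increment [f (y + t *: v) - f y] is within [t * (e / 2)] of [t *: w] by the
    mean value inequality, and of [B *m (t *: v)] by differentiability at [y]. The radius [r] is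
    uniform in [y], while [t] depends on [y] and [B]. *)
Lemma conservative_jac_dir z (v : 'cV[R]_N) (w : 'cV[R]_m) e : D z -> 0 < e ->
  (forall A, J z A -> A *m v = w) ->
  exists r : R, 0 < r /\ forall y B, `|y - z| < r -> has_jac f y B -> `|B *m v - w| <= e.
Proof.
move=> Dz e0 H.
have e20 : 0 < e / 2 by rewrite divr_gt0.
have [r1 [r10 H1]] := conservative_usc_dir Dz e20 H.
have [r2 [K [r20 K0 H2 HK]]] := loc_lipschitz_ball openD lipf Dz.
pose r := Num.min r1 r2.
have r0 : 0 < r by rewrite lt_min r10.
exists r; split => // y B yr /has_jac_epsP HB.
have v1 : 0 < `|v| + 1 by rewrite ltr_wpDl.
have [|d [d0 Hd]] := HB (e / 2 / (`|v| + 1)); first by rewrite divr_gt0.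
have [t [t0 tlt]] : exists t, 0 < t /\
    t < Num.min (d / (`|v| + 1)) ((r - `|y - z|) / (`|v| + 1)).
  pose u := Num.min (d / (`|v| + 1)) ((r - `|y - z|) / (`|v| + 1)).
  have u0 : 0 < u by rewrite lt_min !divr_gt0// subr_gt0.
  by exists (u / 2); rewrite divr_gt0//= ltr_pdivrMr// ltr_pMr ?ltr1n.
move: tlt; rewrite lt_min !ltr_pdivlMr// => /andP[td tr].
have tv : t * `|v| < t * (`|v| + 1) by rewrite ltr_pM2l// ltrDl.
have Sr s : 0 <= s <= 1 -> `|y + s *: (t *: v) - z| < r.
  move=> /andP[s0 s1]; rewrite addrAC (le_lt_trans (ler_normD _ _))//.
  rewrite !normrZ (ger0_norm s0) (gtr0_norm t0) -ltrBrDl.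
  apply: le_lt_trans (lt_trans tv tr).
  by rewrite ler_piMl// mulr_ge0// ltW.
have Sr1 s : 0 <= s <= 1 -> `|y + s *: (t *: v) - z| < r1.
  by move=> /Sr/lt_le_trans; apply; rewrite ge_min lexx.
have Sr2 s : 0 <= s <= 1 -> `|y + s *: (t *: v) - z| < r2.
  by move=> /Sr/lt_le_trans; apply; rewrite ge_min lexx orbT.
have M1 : `|f (y + t *: v) - f y - t *: w| <= t * (e / 2).
  apply: (@conservative_mean_value _ _ _ _ (K * `|t *: v|)).
  - by rewrite mulr_ge0 ?(ltW t0)// ltW.
  - by move=> s /Sr2; exact: H2.
  - move=> s s' s01 s01'; apply: le_trans (HK _ _ (Sr2 _ s01) (Sr2 _ s01')) _.
    rewrite opprD addrACA subrr add0r -scalerBl normrZ.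
    by rewrite -mulrA ler_wpM2l// mulrC.
  - move=> s A s01 JA; rewrite -scalemxAr -scalerBr normrZ (gtr0_norm t0).
    rewrite ler_wpM2l ?(ltW t0)// ltW//; apply: H1 JA; first exact: Sr1.
    by apply: H2; exact: Sr2.
have M2 : `|f (y + t *: v) - f y - B *m (t *: v)| <= t * (e / 2).
  apply: le_trans (Hd _ _) _; first by rewrite normrZ (gtr0_norm t0); exact: lt_trans td.
  rewrite normrZ (gtr0_norm t0) mulrCA ler_wpM2l ?(ltW t0)//.
  by rewrite mulrAC ler_pdivrMr// ler_wpM2l ?(ltW e20)// lerDl.
rewrite -(ler_pM2l t0) -{1}(gtr0_norm t0) -normrZ scalerBr scalemxAr.
have -> : B *m (t *: v) - t *: w = (f (y + t *: v) - f y - t *: w) -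
    (f (y + t *: v) - f y - B *m (t *: v)).
  by rewrite opprB [RHS]addrC addrA subrK.
by rewrite (le_trans (ler_normB _ _))// [in leRHS](splitr e) mulrDr lerD.
Qed.

(** The condition [M *m v = w] is affine in [M]: the preceding estimate gives it for limits of
    Jacobians, and the weights of a convex combination sum to one. *)
Lemma clarke_conservative_dir z (v : 'cV[R]_N) (w : 'cV[R]_m) M : D z ->
  (forall A, J z A -> A *m v = w) -> clarke_jac f z M -> M *m v = w.
Proof.
move=> Dz H [k [c [Ms [_ [c1 [HMs ->]]]]]].
rewrite mulmx_suml (eq_bigr (fun i => c i *: w)); last first.
  move=> i _; rewrite -scalemxAl; congr (_ *: _).
  have [zs [Js [zsz [HJ JM]]]] := HMs i.
  apply/eqP; rewrite -subr_eq0 -normr_le0; apply/ler_addgt0Pr => e e0.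
  rewrite add0r; have [r [r0 Hr]] := conservative_jac_dir Dz e0 H.
  have /cvg_seqP/(_ (r / 2))[|k0 Hk0] := zsz; first by rewrite divr_gt0.
  have C : (fun k => Js k *m v - w) @ \oo --> Ms i *m v - w.
    by apply: cvgB; [apply: cvg_mulmx => //|]; exact: cvg_cst.
  apply: (@cvg_norm_le _ _ _ _ _ k0 C) => l kl; apply: Hr (HJ _).
  apply: le_lt_trans (Hk0 _ kl) _.
  by rewrite ltr_pdivrMr// ltr_pMr// ltr1n.
by rewrite -scaler_suml c1 scale1r.
Qed.

Lemma conservative_singleton_jac z M : D z -> J z M ->
  (forall A, J z A -> A = M) -> has_jac f z M.
Proof.
move=> Dz JM H; apply/has_jac_epsP => e e0.
have [r2 [K [r20 K0 H2 HK]]] := loc_lipschitz_ball openD lipf Dz.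
have N1 : 0 < N%:R + 1 :> R by rewrite ltr_wpDl.
(* Division by [N%:R + 1] compensates the factor [N] in [ler_norm_mulmx]. *)
have [||r1 [r10 H1]] := @conservative_usc (fun A => `|A *m 1%:M - M| < e / (N%:R + 1)) z Dz.
- exact: far_closed.
- by move=> A /H ->; rewrite mulmx1 subrr normr0 divr_gt0.
exists (Num.min r1 r2); split; first by rewrite lt_min r10.
move=> v; rewrite lt_min => /andP[vr1 vr2].
have Sv (s : R) : 0 <= s <= 1 -> `|z + s *: v - z| <= `|v|.
  move=> /andP[s0 s1]; rewrite addrAC subrr add0r normrZ ger0_norm//.
  by rewrite ler_piMl.
have Sr2 (s : R) : 0 <= s <= 1 -> `|z + s *: v - z| < r2.
  by move=> /Sv/le_lt_trans; apply.
apply: (@conservative_mean_value _ _ _ _ (K * `|v|)).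
- by rewrite mulr_ge0// ltW.
- by move=> s /Sr2; exact: H2.
- move=> s s' s01 s01'; apply: le_trans (HK _ _ (Sr2 _ s01) (Sr2 _ s01')) _.
  rewrite opprD addrACA subrr add0r -scalerBl normrZ.
  by rewrite -mulrA ler_wpM2l// mulrC.
- move=> s A s01 JA; rewrite -mulmxBl (le_trans (ler_norm_mulmx _ _))//.
  rewrite mulrA ler_wpM2r//.
  have := H1 _ _ (le_lt_trans (Sv s s01) vr1) (H2 _ (Sr2 s s01)) JA.
  rewrite mulmx1 ltr_pdivlMr// => /ltW; apply: le_trans.
  by rewrite mulrC ler_wpM2l// lerDl.
Qed.

End Conservative.

(** * Caratheodory's theorem for convex hulls of sets of matrices *)

Section Caratheodory.
Variables (R : realType) (m N : nat).
Implicit Type S : set 'M[R]_(m, N).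

(** With more than [m * N + 1] points, the rows made of a vectorised matrix and an entry 1 are
    linearly dependent; shifting the weights along the dependency preserves their sum and the
    barycentre. *)
Lemma caratheodory_step S k (w : 'I_k.+1 -> R) (Ms : 'I_k.+1 -> 'M[R]_(m, N)) :
  (m * N < k)%N -> (forall i, 0 <= w i) -> \sum_i w i = 1 -> (forall i, S (Ms i)) ->
  exists (w' : 'I_k -> R) (Ms' : 'I_k -> 'M[R]_(m, N)),
    (forall i, 0 <= w' i) /\ \sum_i w' i = 1 /\ (forall i, S (Ms' i)) /\
    \sum_i w i *: Ms i = \sum_i w' i *: Ms' i.
Proof.
move=> mNk w0 w1 SM.
pose P : 'M[R]_(k.+1, m * N + 1) :=
  \matrix_(i < k.+1) row_mx (mxvec (Ms i)) (1%:M : 'M[R]_1).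
have kP : kermx P != 0.
  rewrite -mxrank_eq0 mxrank_ker subn_eq0 -ltnNge ltnS.
  by rewrite (leq_trans (rank_leq_col P))// addn1.
pose l := nz_row (kermx P).
have l0 : l != 0 by rewrite nz_row_eq0.
have lP : \sum_i l ord0 i *: row_mx (mxvec (Ms i)) (1%:M : 'M[R]_1) = 0.
  have /sub_kermxP := nz_row_sub (kermx P); rewrite -/l mulmx_sum_row => H.
  rewrite -[RHS]H; apply: eq_bigr => i _; rewrite rowK.
  by congr (l _ _ *: _); exact: ord1.
have lM : \sum_i l ord0 i *: Ms i = 0.
  have H : vec_mx (lsubmx (\sum_i l ord0 i *: row_mx (mxvec (Ms i)) (1%:M : 'M[R]_1))) = 0.
    by rewrite lP !linear0.
  rewrite -[RHS]H !linear_sum; apply: eq_bigr => i _.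
  by rewrite !linearZ/= row_mxKl mxvecK.
have l1 : \sum_i l ord0 i = 0.
  have H : rsubmx (\sum_i l ord0 i *: row_mx (mxvec (Ms i)) (1%:M : 'M[R]_1)) ord0 ord0 = 0.
    by rewrite lP linear0 mxE.
  rewrite -[RHS]H linear_sum summxE; apply: eq_bigr => i _.
  by rewrite linearZ/= row_mxKr !mxE eqxx mulr1.
have [i1 li1] : exists i, 0 < l ord0 i.
  apply: contrapT => nl; move/eqP: l0; apply; apply/rowP => i; rewrite [RHS]mxE.
  have ln j : l ord0 j <= 0.
    by rewrite leNgt; apply/negP => lj; apply: nl; exists j.
  have : \sum_i - l ord0 i == 0 by rewrite sumrN l1 oppr0.
  rewrite psumr_eq0; last by move=> j _; rewrite oppr_ge0.
  by move=> /allP/(_ i); rewrite mem_index_enum => /(_ isT)/=; rewrite oppr_eq0 => /eqP.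
pose P1 := [pred i | 0 < l ord0 i].
have [i0 /= li0 Hmin] := @Order.TotalTheory.arg_minP _ _ _ i1 P1 (fun i => w i / l ord0 i) li1.
(* The smallest ratio over the positive coefficients: the weight at [i0] vanishes and no weight
   becomes negative. *)
pose t := w i0 / l ord0 i0.
have t0 : 0 <= t by rewrite divr_ge0// ltW.
pose v i := w i - t * l ord0 i.
have v0 : v i0 = 0 by rewrite /v /t divfK ?subrr// gt_eqF.
have sumv : \sum_i v i = 1 by rewrite sumrB -mulr_sumr l1 mulr0 subr0.
have sumvM : \sum_i v i *: Ms i = \sum_i w i *: Ms i.
  under eq_bigr do rewrite scalerBl -scalerA.
  by rewrite sumrB -scaler_sumr lM scaler0 subr0.
exists (fun j => v (lift i0 j)), (fun j => Ms (lift i0 j)); split; last split; last split.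
- move=> j; rewrite subr_ge0; case: (ltrP 0 (l ord0 (lift i0 j))) => lj.
    by rewrite -ler_pdivlMr//; exact: Hmin.
  by rewrite (le_trans _ (w0 _))// mulr_ge0_le0.
- by rewrite -sumv [RHS](bigD1_ord i0)//= v0 add0r.
- by move=> j.
- by rewrite -sumvM [LHS](bigD1_ord i0)//= v0 scale0r add0r.
Qed.

Lemma caratheodory S M : mx_conv S M ->
  exists (w : 'I_(m * N).+1 -> R) (Ms : 'I_(m * N).+1 -> 'M[R]_(m, N)),
    (forall i, 0 <= w i) /\ \sum_i w i = 1 /\ (forall i, S (Ms i)) /\
    M = \sum_i w i *: Ms i.
Proof.
move=> [k]; elim: k => [|k IH] [w [Ms [w0 [w1 [SM ME]]]]].
  by exfalso; move: w1; rewrite big_ord0 => /eqP; rewrite eq_sym oner_eq0.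
have [mNk|kmN] := ltnP (m * N) k.
  have [w' [Ms' [? [? [? E]]]]] := caratheodory_step mNk w0 w1 SM.
  by apply: IH; exists w', Ms'; rewrite ME E.
rewrite {}ME.
rewrite -(subnKC (kmN : (k.+1 <= (m * N).+1)%N)).
pose q := ((m * N).+1 - k.+1)%N.
(* Short combinations are padded with zero weights and copies of [Ms ord0], so that all combinations
   have the same length. *)
exists (fun i : 'I_(k.+1 + q) => match fintype.split i with inl j => w j | inr _ => 0 end).
exists (fun i : 'I_(k.+1 + q) => match fintype.split i with inl j => Ms j | inr _ => Ms ord0 end).
have splitl (j : 'I_k.+1) : fintype.split (lshift q j) = inl j.
  exact: (unsplitK (inl j)).
have splitr (j : 'I_q) : fintype.split (rshift k.+1 j) = inr j.
  exact: (unsplitK (inr j)).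
split; first by move=> i; case: fintype.splitP.
split.
  rewrite big_split_ord/= [X in _ + X]big1 ?addr0//; last by move=> i _; rewrite splitr.
  by rewrite -w1; apply: eq_bigr => i _; rewrite splitl.
split; first by move=> i; case: fintype.splitP.
rewrite big_split_ord/= [X in _ = _ + X]big1 ?addr0//; last first.
  by move=> i _; rewrite splitr scale0r.
by apply: eq_bigr => i _; rewrite splitl.
Qed.

Lemma mx_conv_norm_le S K M : (forall A, S A -> `|A| <= K) -> mx_conv S M -> `|M| <= K.
Proof.
move=> SK [k [w [Ms [w0 [w1 [SM ->]]]]]].
rewrite (le_trans (ler_norm_sum _ _ _))// -[leRHS]mul1r -w1 mulr_suml.
by apply: ler_sum => i _; rewrite normrZ ger0_norm// ler_wpM2l// SK.
Qed.

Lemma sub_mx_conv S M : S M -> mx_conv S M.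
Proof.
move=> SM; exists 1%N, (fun=> 1), (fun=> M).
by rewrite !big_ord1 scale1r.
Qed.

End Caratheodory.

(* Joins the norm with the completeness structure, for Baire's theorem and the
   Banach fixed point theorem. *)
HB.instance Definition _ (R : realType) (m n : nat) := NormedModule.on 'M[R]_(m, n).

(** * Density of the points of differentiability *)

Section Density.
Variables (R : realType) (N m : nat) (D : set 'cV[R]_N).
Variables (f : 'cV[R]_N -> 'cV[R]_m) (J : 'cV[R]_N -> set 'M[R]_(m, N)).
Hypotheses (openD : open D) (lipf : loc_lipschitz_on D f).
Hypothesis consJ : conservative_on D f J.

(* Along a segment in direction [e_i], [A *m e_i] is a derivative, hence independent
   of [A] in [J], at almost every point. *)
Lemma conservative_coord_singleton z (r : R) (i : 'I_N) : 0 < r ->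
  (forall y, `|y - z| < r -> D y) ->
  exists y w, `|y - z| < r /\ forall A, J y A -> A *m delta_mx i (ord0 : 'I_1) = w.
Proof.
move=> r0 Hr; have [_ [_ [_ Jc]]] := consJ.
pose ei : 'cV[R]_N := delta_mx i ord0.
pose v := (r / 2) *: ei.
have r20 : 0 < r / 2 by rewrite divr_gt0.
have vr : `|v| <= r / 2.
  by rewrite /v normrZ (gtr0_norm r20) ler_piMr ?(ltW r20)// norm_delta_mx_le.
have near (s : R) : 0 <= s <= 1 -> `|z + s *: v - z| < r.
  move=> /andP[s0 s1]; rewrite addrAC subrr add0r normrZ ger0_norm//.
  apply: le_lt_trans (_ : r / 2 < r); last by rewrite ltr_pdivrMr// ltr_pMr// ltr1n.
  by apply: le_trans vr; rewrite ler_piMl.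
have /ae_unit_interval[t [t01 [_ [_ Ht]]]] :=
  Jc _ (line_abs_cont z v) (fun s s01 => Hr _ (near s s01)).
exists (z + t *: v), ((r / 2)^-1 *: derive1 (f \o (fun s : R => z + s *: v)) t).
split; first exact: near.
move=> A JA; rewrite (Ht A JA) line_derive1 /v -scalemxAr scalerA mulVf ?scale1r//.
by rewrite gt_eqF.
Qed.

(** The neighbourhood in the condition makes the set open. Restricting [y'] to [D] leaves the
    condition void away from [D], so that density holds in the whole space, where Baire's theorem is
    applied. *)
Let coord_osc_lt (i : 'I_N) (k : nat) : set 'cV[R]_N :=
  [set y | exists r : R, 0 < r /\ forall y' A A', `|y' - y| < r -> D y' ->
     J y' A -> J y' A' -> `|A *m delta_mx i (ord0 : 'I_1) - A' *m delta_mx i ord0| < k.+1%:R^-1].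

Let coord_osc_open i k : open (coord_osc_lt i k).
Proof.
rewrite openE => y [r [r0 Hr]]; apply/(@nbhs_epsP R 'cV[R]_N).
exists (r / 2); split; first by rewrite divr_gt0.
move=> y1 y1y; exists (r / 2); split; first by rewrite divr_gt0.
move=> y' A A' yy1; apply: Hr.
by rewrite (splitr r) -(subrKA y1) (le_lt_trans (ler_normD _ _))// ltrD.
Qed.

Let coord_osc_dense i k : dense (coord_osc_lt i k).
Proof.
move=> U [y Uy] oU.
have [[y1 [Uy1 Dy1]]|nD] := pselect (exists y, U y /\ D y); last first.
  exists y; split => //.
  have /(@nbhs_epsP R 'cV[R]_N)[r [r0 Hr]] := open_nbhs_nbhs (conj oU Uy).
  exists r; split => // y' A A' /Hr Uy' Dy'.
  by exfalso; apply: nD; exists y'.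
have [r1 [r10 Hr1]] := open_ball_sub oU Uy1.
have [r2 [r20 Hr2]] := open_ball_sub openD Dy1.
have r0 : 0 < Num.min r1 r2 by rewrite lt_min r10.
have [|y2 [w [y2r Hw]]] := @conservative_coord_singleton y1 _ i r0.
  by move=> y2; rewrite lt_min => /andP[_]; exact: Hr2.
move: y2r; rewrite lt_min => /andP[/Hr1 Uy2 /Hr2 Dy2].
exists y2; split => //.
have e0 : 0 < k.+1%:R^-1 / 2 :> R by rewrite divr_gt0// invr_gt0.
have [r [r0' Hr]] := conservative_usc_dir consJ Dy2 e0 Hw.
exists r; split => // y' A A' y'r Dy' JA JA'.
rewrite (splitr k.+1%:R^-1) -(subrKA w) (le_lt_trans (ler_normD _ _))//.
rewrite ltrD//; first exact: Hr JA.
by rewrite -normrN opprB; exact: Hr JA'.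
Qed.

Lemma conservative_differentiable_dense z (r : R) : D z -> 0 < r ->
  exists y M, [/\ `|y - z| < r, D y & has_jac f y M].
Proof.
move=> Dz r0.
have [r1 [r10 Hr1]] := open_ball_sub openD Dz.
(* Pairs of a direction and a precision are enumerated by [pickle]; numbers that code no pair
   receive the whole space. *)
pose F (j : nat) := match (unpickle j : option ('I_N * nat)) with
  | Some ik => coord_osc_lt ik.1 ik.2 | None => setT end.
have [|||y [yr yF]] := @Baire R 'cV[R]_N F _ [set y | `|y - z| < Num.min r r1].
- move=> j; rewrite /F; case: unpickle => [[i k]|]; first by split.
  by split; [exact: openT|move=> U U0 _; rewrite setIT].
- by exists z; rewrite /= subrr normr0 lt_min r0.
- rewrite openE => y /= yr; apply/(@nbhs_epsP R 'cV[R]_N).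
  exists (Num.min r r1 - `|y - z|); split; first by rewrite subr_gt0.
  move=> y' y'y; rewrite /= -(subrKA y) (le_lt_trans (ler_normD _ _))//.
  by rewrite -ltrBrDr.
move: yr; rewrite /= lt_min => /andP[yr /Hr1 Dy].
have [Jne _] := consJ; have [M JM] := Jne y Dy.
exists y, M; split => //; apply: (conservative_singleton_jac openD lipf consJ) => //.
(* Every precision holds at [y' = y] itself, so two elements of [J y] agree on each basis vector. *)
move=> A JA; apply: mulmx_ext => i; apply/eqP; rewrite -subr_eq0 -normr_le0.
apply/ler_addgt0Pr => e e0; rewrite add0r.
have := yF (pickle (i, Num.truncn e^-1)) I; rewrite /F pickleK => -[s [s0 Hs]].
apply: ltW; apply: (lt_le_trans (Hs y A M _ Dy JA JM)).
  by rewrite subrr normr0.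
rewrite invf_ple ?posrE//; apply: ltW.
exact: (Num.Theory.truncnS_gt _).
Qed.

End Density.

(** * Clarke Jacobians *)

Section LimitingJacobian.
Variables (R : realType) (N m : nat).
Implicit Type f : 'cV[R]_N -> 'cV[R]_m.

(** The set whose convex hull is [clarke_jac], also called the Bouligand subdifferential. *)
Definition limiting_jac f (z : 'cV[R]_N) : set 'M[R]_(m, N) :=
  [set M | exists (zs : nat -> 'cV[R]_N) (Js : nat -> 'M[R]_(m, N)),
     zs @ \oo --> z /\ (forall k, has_jac f (zs k) (Js k)) /\ Js @ \oo --> M].

(** With one [e] for both distances, closedness under limits becomes a halving of [e]. *)
Lemma limiting_jacP f z M : limiting_jac f z M <->
  forall e, 0 < e -> exists y B, [/\ `|y - z| <= e, `|B - M| <= e & has_jac f y B].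
Proof.
split=> [[zs [Js [/cvg_seqP zsz [HJ /cvg_seqP JM]]]] e e0|H].
  have [k1 H1] := zsz e e0; have [k2 H2] := JM e e0.
  exists (zs (maxn k1 k2)), (Js (maxn k1 k2)).
  by split; [apply: H1; rewrite leq_maxl|apply: H2; rewrite leq_maxr|].
(* The radius itself is taken as the variable point, converging to 0, so that one extraction
   controls point and Jacobian together. *)
have [|t [a [t0 Hta]]] := @exists_seq_cvg R R ('cV[R]_N * 'M[R]_(m, N))%type
   (fun t a => [/\ `|a.1 - z| <= t, `|a.2 - M| <= t & has_jac f a.1 a.2]) 0.
  move=> e e0; have [y [B HyB]] := H e e0.
  by exists e, (y, B); rewrite subr0 gtr0_norm.
exists (fun k => (a k).1), (fun k => (a k).2); split; last split.
- apply/cvg_seqP => e /(proj1 (cvg_seqP _ _) t0 e)[k0 Hk0].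
  exists k0 => k /Hk0; rewrite subr0; apply: le_trans.
  by have [h _ _] := Hta k; apply: le_trans h (ler_norm _).
- by move=> k; case: (Hta k).
- apply/cvg_seqP => e /(proj1 (cvg_seqP _ _) t0 e)[k0 Hk0].
  exists k0 => k /Hk0; rewrite subr0; apply: le_trans.
  by have [_ h _] := Hta k; apply: le_trans h (ler_norm _).
Qed.

Lemma limiting_jac_closed f (zs : nat -> 'cV[R]_N) (Ms : nat -> 'M[R]_(m, N)) z M :
  (forall k, limiting_jac f (zs k) (Ms k)) -> zs @ \oo --> z -> Ms @ \oo --> M ->
  limiting_jac f z M.
Proof.
move=> H /cvg_seqP zsz /cvg_seqP MsM; apply/limiting_jacP => e e0.
have e20 : 0 < e / 2 by rewrite divr_gt0.
have [k1 H1] := zsz _ e20; have [k2 H2] := MsM _ e20.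
pose k := maxn k1 k2.
have /limiting_jacP/(_ _ e20)[y [B [yz BM HB]]] := H k.
exists y, B; split => //.
- rewrite -(subrKA (zs k)) (le_trans (ler_normD _ _))// [leRHS]splitr lerD//.
  by apply: H1; rewrite leq_maxl.
- rewrite -(subrKA (Ms k)) (le_trans (ler_normD _ _))// [leRHS]splitr lerD//.
  by apply: H2; rewrite leq_maxr.
Qed.

Lemma has_jac_cvg f y B v : has_jac f y B ->
  (fun k : nat => k.+1%:R *: (f (y + k.+1%:R^-1 *: v) - f y)) @ \oo --> B *m v.
Proof.
move=> /has_jac_epsP H; apply/cvg_seqP => e e0.
have v1 : 0 < `|v| + 1 by rewrite ltr_wpDl.
have [|d [d0 Hd]] := H (e / (`|v| + 1)); first by rewrite divr_gt0.
exists (Num.truncn ((`|v| + 1) / d)) => k Nk.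
have k0 : 0 < k.+1%:R :> R by [].
have vd : `|k.+1%:R^-1 *: v| < d.
  rewrite normrZ gtr0_norm ?invr_gt0// mulrC ltr_pdivrMr//.
  apply: (@lt_le_trans _ _ (`|v| + 1)); first by rewrite ltrDl.
  rewrite mulrC -ler_pdivrMr//; apply: ltW.
  by apply: (lt_le_trans (Num.Theory.truncnS_gt _)); rewrite ler_nat.
have -> : k.+1%:R *: (f (y + k.+1%:R^-1 *: v) - f y) - B *m v =
    k.+1%:R *: (f (y + k.+1%:R^-1 *: v) - f y - B *m (k.+1%:R^-1 *: v)).
  by rewrite [RHS]scalerBr -scalemxAr scalerA divff ?scale1r// gt_eqF.
rewrite normrZ (gtr0_norm k0) (le_trans (ler_wpM2l (ltW k0) (Hd _ vd)))//.
rewrite normrZ (@gtr0_norm _ k.+1%:R^-1) ?invr_gt0//.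
rewrite mulrCA mulVKf ?gt_eqF//.
by rewrite mulrAC ler_pdivrMr// ler_wpM2l ?(ltW e0)// lerDl.
Qed.

Lemma has_jac_norm_le f z (r K : R) y B : 0 <= K ->
  (forall x y, `|x - z| < r -> `|y - z| < r -> `|f x - f y| <= K * `|x - y|) ->
  `|y - z| < r -> has_jac f y B -> `|B| <= K.
Proof.
move=> K0 HK yr HB; apply: mx_norm_le_mulmx => // v.
have v1 : 0 < `|v| + 1 by rewrite ltr_wpDl.
have d0 : 0 < r - `|y - z| by rewrite subr_gt0.
apply: (@cvg_norm_le R 'cV[R]_m _ _ (K * `|v|)
  (Num.truncn ((`|v| + 1) / (r - `|y - z|))) (@has_jac_cvg f y B v HB)) => k Nk.
have k0 : 0 < k.+1%:R :> R by [].
have vn : `|k.+1%:R^-1 *: v| = k.+1%:R^-1 * `|v|.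
  by rewrite normrZ gtr0_norm ?invr_gt0.
have vd : `|k.+1%:R^-1 *: v| < r - `|y - z|.
  rewrite vn mulrC ltr_pdivrMr//.
  apply: (@lt_le_trans _ _ (`|v| + 1)); first by rewrite ltrDl.
  rewrite mulrC -ler_pdivrMr//; apply: ltW.
  by apply: (lt_le_trans (Num.Theory.truncnS_gt _)); rewrite ler_nat.
rewrite normrZ (gtr0_norm k0).
apply: le_trans (ler_wpM2l (ltW k0) (HK _ _ _ yr)) _.
  by rewrite addrAC (le_lt_trans (ler_normD _ _))// -ltrBrDl.
by rewrite [_ - y]addrAC subrr add0r vn mulrCA mulVKf// gt_eqF.
Qed.

Lemma limiting_jac_norm_le f z (r K : R) y B : 0 <= K ->
  (forall x y, `|x - z| < r -> `|y - z| < r -> `|f x - f y| <= K * `|x - y|) ->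
  `|y - z| < r -> limiting_jac f y B -> `|B| <= K.
Proof.
move=> K0 HK yr [zs [Js [/cvg_seqP zsy [HJ JB]]]].
have d0 : 0 < (r - `|y - z|) / 2 by rewrite divr_gt0// subr_gt0.
have [k0 Hk0] := zsy _ d0.
apply: (@cvg_norm_le _ _ _ _ _ k0 JB) => k /Hk0 Hk.
apply: has_jac_norm_le K0 HK _ (HJ k).
rewrite -(subrKA y) (le_lt_trans (ler_normD _ _))// -ltrBrDr.
by apply: le_lt_trans Hk _; rewrite ltr_pdivrMr// ltr_pMr ?ltr1n// subr_gt0.
Qed.

(* Caratheodory bounds the number of points of the convex combinations, so that
   all weights and points converge along a common subsequence. *)
Lemma clarke_jac_closed f (zs : nat -> 'cV[R]_N) (Ms : nat -> 'M[R]_(m, N)) z M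
    (r K : R) : 0 <= K -> 0 < r ->
  (forall x y, `|x - z| < r -> `|y - z| < r -> `|f x - f y| <= K * `|x - y|) ->
  (forall k, clarke_jac f (zs k) (Ms k)) -> zs @ \oo --> z -> Ms @ \oo --> M ->
  clarke_jac f z M.
Proof.
move=> K0 r0 HK H zsz MsM.
have r20 : 0 < r / 2 by rewrite divr_gt0.
have /cvg_seqP/(_ _ r20)[k0 Hk0] := zsz.
pose I := 'I_(m * N).+1.
have /choice [wA HwA] : forall k, exists wA : (I -> R) * (I -> 'M[R]_(m, N)),
    [/\ forall i, 0 <= wA.1 i, \sum_i wA.1 i = 1,
       forall i, limiting_jac f (zs (k + k0)%N) (wA.2 i) &
       Ms (k + k0)%N = \sum_i wA.1 i *: wA.2 i].
  move=> k; have [w [A [w0 [w1 [HA E]]]]] := caratheodory (H (k + k0)%N).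
  by exists (w, A).
have [|s1 [s1i [w Hw]]] := @bounded_family_subseq R I (fun k i => (wA k).1 i) 1.
  move=> k i; have [w0 w1 _ _] := HwA k; rewrite ger0_norm// -w1 (bigD1 i)//=.
  by rewrite lerDl sumr_ge0.
have Ab k i : `|(wA k).2 i| <= K.
  have [_ _ HA _] := HwA k; apply: limiting_jac_norm_le K0 HK _ (HA i).
  apply: le_lt_trans (Hk0 _ (leq_addl _ _)) _.
  by rewrite ltr_pdivrMr// ltr_pMr// ltr1n.
have [|s2 [s2i [A HA]]] := @bounded_family_subseq R (I * ('I_m * 'I_N))%type
    (fun k ij => (wA (s1 k)).2 ij.1 ij.2.1 ij.2.2) K.
  by move=> k ij; exact: le_trans (ler_norm_entry _ _ _) (Ab _ _).
pose A' i : 'M[R]_(m, N) := \matrix_(a, b) A (i, (a, b)).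
have wC i : (fun k => (wA (s1 (s2 k))).1 i) @ \oo --> w i.
  exact: (@cvg_subseq R R _ _ _ s2i (Hw i)).
have AC i : (fun k => (wA (s1 (s2 k))).2 i) @ \oo --> A' i.
  by apply/cvg_mxP => a b; rewrite mxE; exact: (HA (i, (a, b))).
have si : increasing_seq (s1 \o s2) by exact: increasing_seq_comp.
have zsC : (fun k => zs (s1 (s2 k) + k0)%N) @ \oo --> z.
  apply: (@cvg_subseq _ _ (fun k => zs (k + k0)%N) _ _ si).
  by rewrite (cvg_shiftn k0 zs).
have MsC : (fun k => Ms (s1 (s2 k) + k0)%N) @ \oo --> M.
  apply: (@cvg_subseq _ _ (fun k => Ms (k + k0)%N) _ _ si).
  by rewrite (cvg_shiftn k0 Ms).
exists (m * N).+1, w, A'; split; last split; last split.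
- move=> i; rewrite -(cvg_lim _ (wC i))//; apply: limr_ge.
    by apply/cvg_ex; exists (w i).
  by apply: nearW => k; case: (HwA (s1 (s2 k))).
- apply: (@cvg_unique_seq R R (fun k => \sum_i (wA (s1 (s2 k))).1 i)).
    exact: cvg_sum_fin.
  rewrite (_ : (fun _ => _) = cst 1); first exact: cvg_cst.
  by apply/funext => k; case: (HwA (s1 (s2 k))).
- move=> i; apply: (limiting_jac_closed _ zsC (AC i)) => k.
  by case: (HwA (s1 (s2 k))).
- apply: (cvg_unique_seq MsC).
  rewrite (_ : (fun _ => _) = (fun k => \sum_i (wA (s1 (s2 k))).1 i *: (wA (s1 (s2 k))).2 i)).
    by apply: cvg_sum_fin => i; apply: cvgZ.
  by apply/funext => k; case: (HwA (s1 (s2 k))).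
Qed.

End LimitingJacobian.

(** Values exist because differentiability points are dense and Jacobians near [z] are bounded by
    the Lipschitz constant. The chain rule holds outside the null set belonging to [J], where every
    [A] in [J (c t)] sends the velocity to the derivative of [f \o c]. *)
Lemma clarke_conservative (R : realType) N m (D : set 'cV[R]_N) (f : 'cV[R]_N -> 'cV[R]_m) :
  open D -> path_diff_on D f -> conservative_on D f (clarke_jac f).
Proof.
move=> oD [lf [J cJ]]; split; last split; last split.
- move=> z Dz; have [r [K [r0 K0 HD HK]]] := loc_lipschitz_ball oD lf Dz.
  have [|zs [Js [zsz HJ]]] := @exists_seq_cvg R 'cV[R]_N 'M[R]_(m, N)
      (fun y B => `|y - z| < r /\ has_jac f y B) z.
    move=> e e0; have [|y [B [ye _ HB]]] :=
        @conservative_differentiable_dense _ _ _ _ _ _ oD lf cJ z (Num.min e r) Dz.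
      by rewrite lt_min e0.
    move: ye; rewrite lt_min => /andP[ye yr].
    by exists y, B; split; [exact: ltW|].
  have [|s [si [M JM]]] := @bounded_mx_subseq R _ _ Js K.
    by move=> k; have [yr HB] := HJ k; exact: has_jac_norm_le K0 HK yr HB.
  exists M; apply: sub_mx_conv; exists (zs \o s), (Js \o s); split; last split => //.
    exact: (cvg_subseq si zsz).
  by move=> k; case: (HJ (s k)).
- move=> z Dz; have [r [K [r0 K0 HD HK]]] := loc_lipschitz_ball oD lf Dz.
  exists r, K; split => // y M Dy; rewrite -ball_normE/= distrC => yr.
  apply: mx_conv_norm_le => A; exact: limiting_jac_norm_le K0 HK yr.
- move=> zs Ms z M Dzs HM Dz zsz MsM.
  have [r [K [r0 K0 HD HK]]] := loc_lipschitz_ball oD lf Dz.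
  exact: clarke_jac_closed K0 r0 HK HM zsz MsM.
- move=> c cac cD; have [Jne [_ [_ Jc]]] := cJ.
  have [B [mB B0 BP]] := Jc c cac cD; exists B; split => //.
  move=> t nt; apply: BP => Ht; apply: nt => t01.
  have [dc [df HA]] := Ht t01; split => //; split => // M HM.
  have Dct : D (c t) by apply: cD; move: t01; rewrite /= in_itv.
  apply/esym; apply: (clarke_conservative_dir oD lf cJ Dct _ HM) => A JA.
  exact: esym (HA A JA).
Qed.

(** * Convex analysis *)

Section Euclidean.
Variables (R : realType) (n : nat).
Implicit Types x y z : 'cV[R]_n.

Definition edot x y : R := \sum_(i < n) x i ord0 * y i ord0.

Lemma enorm2E x : enorm2 x = edot x x.
Proof. by apply: eq_bigr => i _; rewrite expr2. Qed.

Lemma edotC x y : edot x y = edot y x.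
Proof. by apply: eq_bigr => i _; rewrite mulrC. Qed.

Lemma edotDl x y z : edot (x + y) z = edot x z + edot y z.
Proof. by rewrite -big_split; apply: eq_bigr => i _; rewrite mxE mulrDl. Qed.

Lemma edotZl a x y : edot (a *: x) y = a * edot x y.
Proof. by rewrite [RHS]mulr_sumr; apply: eq_bigr => i _; rewrite mxE mulrA. Qed.

Lemma edotNl x y : edot (- x) y = - edot x y.
Proof. by rewrite -scaleN1r edotZl mulN1r. Qed.

Lemma edotDr x y z : edot z (x + y) = edot z x + edot z y.
Proof. by rewrite !(edotC z) edotDl. Qed.

Lemma edotZr a x y : edot x (a *: y) = a * edot x y.
Proof. by rewrite !(edotC x) edotZl. Qed.

Lemma edotNr x y : edot x (- y) = - edot x y.
Proof. by rewrite !(edotC x) edotNl. Qed.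

Definition edotE := (edotDl, edotDr, edotNl, edotNr, edotZl, edotZr).

Lemma edot_suml (I : finType) (u : I -> 'cV[R]_n) y :
  edot (\sum_i u i) y = \sum_i edot (u i) y.
Proof.
rewrite exchange_big/=; apply: eq_bigr => i _.
by rewrite summxE mulr_suml.
Qed.

Lemma enorm2_ge0 x : 0 <= enorm2 x.
Proof. by apply: sumr_ge0 => i _; rewrite sqr_ge0. Qed.

Lemma enorm2_eq0 x : enorm2 x <= 0 -> x = 0.
Proof.
move=> H; have : enorm2 x == 0 by rewrite eq_le H enorm2_ge0.
rewrite psumr_eq0; last by move=> i _; rewrite sqr_ge0.
move=> /allP h; apply/matrixP => i j; rewrite ord1 mxE.
by have := h i; rewrite mem_index_enum sqrf_eq0 => /(_ isT)/eqP.
Qed.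

Lemma enorm2Z a x : enorm2 (a *: x) = a ^+ 2 * enorm2 x.
Proof. by rewrite !enorm2E !edotE mulrA expr2. Qed.

Lemma enorm2_distC x y : enorm2 (x - y) = enorm2 (y - x).
Proof. by rewrite !enorm2E !edotE; rewrite (edotC y x); ring. Qed.

Lemma sqr_enorm x : enorm x ^+ 2 = enorm2 x.
Proof. by rewrite sqr_sqrtr// enorm2_ge0. Qed.

Lemma sqr_norm_le_enorm2 x : `|x| ^+ 2 <= enorm2 x.
Proof.
have -> : enorm2 x = Num.sqrt (enorm2 x) ^+ 2 by rewrite sqr_sqrtr// enorm2_ge0.
rewrite lerXn2r ?nnegrE ?sqrtr_ge0//; apply: mx_norm_leP => [|i j].
  exact: sqrtr_ge0.
rewrite ord1 -sqrtr_sqr ler_sqrt ?enorm2_ge0// /enorm2 (bigD1 i)//= lerDl.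
by apply: sumr_ge0 => k _; rewrite sqr_ge0.
Qed.

Lemma enorm2_le_sqr_norm x : enorm2 x <= n%:R * `|x| ^+ 2.
Proof.
rewrite (@le_trans _ _ (\sum_(i < n) `|x| ^+ 2))//; last first.
  by rewrite sumr_const card_ord mulr_natl.
apply: ler_sum => i _; rewrite -[leLHS]real_normK ?num_real// lerXn2r ?nnegrE//.
exact: ler_norm_entry.
Qed.

Lemma enorm2_cvg (u : nat -> 'cV[R]_n) x :
  u @ \oo --> x -> (fun k => enorm2 (u k)) @ \oo --> enorm2 x.
Proof.
move=> /cvg_mxP H; apply: cvg_sum_fin => i.
under eq_fun do rewrite expr2.
by rewrite expr2; apply: cvgM; exact: H.
Qed.

(** With [x] the barycentre, [2 * enorm2 x] is the weighted sum of [2 * edot (u i) x], and each of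
    these is at most [enorm2 (u i) + enorm2 x]. *)
Lemma enorm2_conv_le k (w : 'I_k -> R) (u : 'I_k -> 'cV[R]_n) s :
  (forall i, 0 <= w i) -> \sum_i w i = 1 -> (forall i, enorm2 (u i) <= s) ->
  enorm2 (\sum_i w i *: u i) <= s.
Proof.
move=> w0 w1 us; set x := \sum_i _.
suff : 2 * enorm2 x <= s + enorm2 x by lra.
rewrite {1}enorm2E {1}/x edot_suml mulr_sumr -[leRHS]mul1r -[X in _ <= X * _]w1 mulr_suml.
apply: ler_sum => i _; rewrite edotZl mulrCA ler_wpM2l//.
have := enorm2_ge0 (u i - x); have := us i.
by rewrite !enorm2E !edotE (edotC x (u i)); lra.
Qed.

(* Young's inequality absorbs the contracted part of [d]. *)
Lemma contraction_absorb (q : R) : 0 <= q < 1 -> exists K : R, 0 <= K /\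
  forall d x c, d = x + c -> enorm2 x <= q * enorm2 d -> `|d| <= K * `|c|.
Proof.
move=> /andP[q0 q1].
(* Then [q = 1 - 2 * h] and [(1 + h) * q <= 1 - h], which leaves [h * enorm2 d] on the left. *)
pose h := (1 - q) / 2; have h0 : 0 < h by rewrite divr_gt0// subr_gt0.
pose C := h^-1 * (1 + h^-1).
have C0 : 0 <= C by rewrite mulr_ge0 ?addr_ge0 ?invr_ge0// ltW.
(* [C * n%:R] bounds the ratio of the squared max norms; since [r <= (r + 1)^2] for [r >= 0], adding
   1 avoids a square root. *)
exists (C * n%:R + 1); split; first by rewrite addr_ge0// mulr_ge0.
move=> d x c dE xd.
have Y : enorm2 d <= (1 + h) * enorm2 x + (1 + h^-1) * enorm2 c.
  have h1 := enorm2_ge0 (h *: x - c).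
  have E : h^-1 * enorm2 (h *: x - c) = h * enorm2 x - 2 * edot x c + h^-1 * enorm2 c.
    rewrite !enorm2E !edotE (edotC c x); field; exact: lt0r_neq0.
  have hV : 0 <= h^-1 by rewrite invr_ge0 ltW.
  have := mulr_ge0 hV h1.
  rewrite E dE !enorm2E !edotE (edotC c x); lra.
have Y2 : h * enorm2 d <= (1 + h^-1) * enorm2 c.
  have e0 := enorm2_ge0 d.
  have : (1 + h) * enorm2 x <= (1 + h) * (q * enorm2 d).
    by rewrite ler_wpM2l// addr_ge0// ltW.
  have : 0 <= (1 - h) * (1 - q) / 2 * enorm2 d.
    by rewrite !mulr_ge0// ?subr_ge0 ?(ltW q1)// /h; lra.
  have -> : q = 1 - 2 * h by rewrite /h; field.
  nra.
have Y3 : enorm2 d <= C * enorm2 c.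
  by rewrite /C -mulrA mulrC ler_pdivlMr// mulrC.
have Cn : 0 <= C * n%:R by rewrite mulr_ge0.
have Kc : 0 <= (C * n%:R + 1) * `|c| by rewrite mulr_ge0// addr_ge0.
rewrite -ler_sqr ?nnegrE//.
apply: le_trans (sqr_norm_le_enorm2 _) (le_trans Y3 _).
apply: le_trans (ler_wpM2l C0 (enorm2_le_sqr_norm c)) _.
rewrite exprMn mulrA ler_wpM2r ?exprn_ge0//.
nra.
Qed.

End Euclidean.

(** * First-order inequalities for differentiable convex functions *)

Section FirstOrder.
Variables (R : realType) (n : nat).
Implicit Types f h : 'cV[R]_n -> R.

Lemma gradient_epsP f x : differentiable f x -> forall e, 0 < e ->
  exists d : R, 0 < d /\ forall v, `|v| < d ->
    `|f (x + v) - f x - edot (gradient f x) v| <= e * `|v|.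
Proof.
move=> df e e0.
have dE v : 'd f x v = edot (gradient f x) v.
  rewrite {1}[v]matrix_sum_delta linear_sum; apply: eq_bigr => i _.
  by rewrite big_ord1 linearZ/= mxE deriveE// mulrC.
have /eqaddoP/(_ e e0)/(@nbhs_epsP R 'cV[R]_n) [d [d0 Hd]] := diff_locally df.
exists d; split => // v vd.
have /= := Hd v; rewrite subr0 => /(_ vd).
by rewrite !fctE dE opprD addrA [v + x]addrC.
Qed.

Lemma gradient_ray f x v : differentiable f x -> forall e, 0 < e ->
  exists d : R, 0 < d /\ forall t, 0 < t < d ->
    `|f (x + t *: v) - f x - t * edot (gradient f x) v| <= t * e.
Proof.
move=> df e e0.
have v1 : 0 < `|v| + 1 by rewrite ltr_wpDl.
have [|d [d0 Hd]] := gradient_epsP df (e := e / (`|v| + 1)); first by rewrite divr_gt0.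
exists (d / (`|v| + 1)); split; first by rewrite divr_gt0.
move=> t /andP[t0]; rewrite ltr_pdivlMr// => td.
have tv : `|t *: v| <= t * (`|v| + 1).
  by rewrite normrZ (gtr0_norm t0) ler_wpM2l ?(ltW t0)// lerDl.
rewrite -edotZr; apply: le_trans (Hd _ (le_lt_trans tv td)) _.
apply: le_trans (ler_wpM2l _ tv) _; first by rewrite ltW// divr_gt0.
by rewrite mulrCA divfK// gt_eqF.
Qed.

(** For [nu = 0] this is convexity and for [nu > 0] strong convexity, so that both alternatives of
    the theorem are instances with different moduli. *)
Definition modconvex (nu : R) f := forall x y t, 0 <= t <= 1 ->
  f (t *: x + (1 - t) *: y) <= t * f x + (1 - t) * f y - nu / 2 * (t * (1 - t)) * enorm2 (x - y).

Lemma convex_modconvex f : convex_fun f -> modconvex 0 f.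
Proof. by move=> cf x y t t01; rewrite !mul0r subr0; exact: cf. Qed.

Lemma strongly_convex_modconvex a f : strongly_convex_fun a f -> modconvex a f.
Proof.
move=> cf x y t t01; have := cf x y t t01.
rewrite !enorm2E !edotE (edotC y x); lra.
Qed.

(** The modulus inequality on the segment from [x] to [y], divided by [t], as [t] tends to 0. *)
Lemma modconvex_first_order nu f x y : modconvex nu f -> differentiable f x ->
  f x + edot (gradient f x) (y - x) + nu / 2 * enorm2 (y - x) <= f y.
Proof.
move=> cf df; apply/ler_addgt0Pr => e e0.
have e20 : 0 < e / 2 by rewrite divr_gt0.
have [d [d0 Hd]] := gradient_ray (y - x) df e20.
pose E := `|nu / 2 * enorm2 (y - x)| + 1.
have E0 : 0 < E by rewrite ltr_wpDl.
have [t [t0 td t1 tE]] : exists t : R, [/\ 0 < t, t < d, t <= 1 & t * E <= e / 2].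
  exists (Num.min (Num.min (d / 2) 1) (e / 2 / E)); split.
  - by rewrite !lt_min !divr_gt0// ltr01.
  - rewrite (@le_lt_trans _ _ (d / 2))// ?ge_min ?lexx//.
    by rewrite ltr_pdivrMr// ltr_pMr// ltr1n.
  - by rewrite !ge_min lexx orbT.
  - by rewrite -ler_pdivlMr// ge_min lexx orbT.
have t01 : 0 <= t <= 1 by rewrite (ltW t0).
have := cf y x t t01; have -> : t *: y + (1 - t) *: x = x + t *: (y - x).
  by apply/matrixP => i j; rewrite !mxE; ring.
have td' : 0 < t < d by rewrite t0.
have := Hd t td'; rewrite ler_norml => /andP[h1 _] h2.
have h3 : t * (nu / 2 * enorm2 (y - x)) <= e / 2.
  apply: le_trans tE; rewrite ler_wpM2l ?(ltW t0)//.
  by rewrite (le_trans (ler_norm _))// lerDl.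
rewrite -(ler_pM2l t0).
have h4 : t * (t * (nu / 2 * enorm2 (y - x))) <= t * (e / 2) by rewrite ler_pM2l.
lra.
Qed.

Lemma gradient_monotone nu f x y : modconvex nu f ->
  differentiable f x -> differentiable f y ->
  nu * enorm2 (x - y) <= edot (gradient f x - gradient f y) (x - y).
Proof.
move=> cf dx dy.
have := modconvex_first_order y cf dx; have := modconvex_first_order x cf dy.
rewrite (enorm2_distC y x) !edotE; lra.
Qed.

End FirstOrder.

(** * Extended-valued convex functions and optimality conditions *)

Section ExtendedConvex.
Variables (R : realType) (n : nat).
Implicit Types g : 'cV[R]_n -> \bar R.

(** Tested only at points where [g] is finite, so that the right-hand side is real arithmetic. *)
Definition emodconvex (mu : R) g := forall x y gx gy t, 0 < t < 1 ->
  g x = gx%:E -> g y = gy%:E ->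
  (g (t *: x + (1 - t) *: y)%R <=
   (t * gx + (1 - t) * gy - mu / 2 * (t * (1 - t)) * enorm2 (x - y))%:E)%E.

Lemma econvex_emodconvex g : econvex_fun g -> emodconvex 0 g.
Proof.
move=> cg x y gx gy t t01 gxE gyE; rewrite !mul0r subr0.
by have := cg x y t t01; rewrite gxE gyE -!EFinM -EFinD.
Qed.

Lemma estrongly_convex_emodconvex a g : estrongly_convex_fun a g -> emodconvex a g.
Proof.
move=> cg x y gx gy t t01 gxE gyE.
have := cg x y t t01; rewrite gxE gyE -!EFinB -!EFinM -EFinD leeBlDr// -EFinD.
move=> /le_trans; apply; rewrite lee_fin.
rewrite !enorm2E !edotE (edotC y x); lra.
Qed.

Lemma emodconvexZ c mu g : 0 < c -> emodconvex mu g ->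
  emodconvex (c * mu) (fun x => (c%:E * g x)%E).
Proof.
move=> c0 cg x y gx gy t t01.
have fin z (gz : R) : (c%:E * g z = gz%:E)%E -> g z = (gz / c)%:E.
  case: (g z) => [r|H|H].
  - by rewrite -EFinM => -[<-]; rewrite mulrAC divff ?mul1r// gt_eqF.
  - by rewrite gt0_muley ?lte_fin// in H.
  - by rewrite gt0_muleNy ?lte_fin// in H.
move=> /fin gxE /fin gyE.
have := cg x y _ _ t t01 gxE gyE.
rewrite -(@lee_pmul2l _ c%:E) ?lte_fin// -EFinM => /le_trans; apply.
rewrite lee_fin le_eqVlt; apply/orP; left; apply/eqP; field.
by rewrite gt_eqF.
Qed.

(** Comparison of [u] with [u + t *: (v - u)] for small [t]. Here [L] is the directional derivative
    of [h] at [u]: a quadratic [h] gives the optimality condition of the prox, and [h = f] that of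
    the minimizers of [f + g]. *)
Lemma minimizer_variational mu g (h : 'cV[R]_n -> R) (L : 'cV[R]_n -> R) u :
  proper_fun g -> emodconvex mu g ->
  (forall v, (g u + (h u)%:E <= g v + (h v)%:E)%E) ->
  (forall v e, 0 < e -> exists d : R, 0 < d /\ forall t, 0 < t < d ->
     `|h (u + t *: v) - h u - t * L v| <= t * e) ->
  exists gu, g u = gu%:E /\ forall v gv, g v = gv%:E ->
    gu + mu / 2 * enorm2 (u - v) <= gv + L (v - u).
Proof.
move=> [gNy [v0 v0y]] cg mg Hh.
have gu_fin : g u \is a fin_num.
  have h1 := mg v0; rewrite fin_numElt (gNy u)/=.
  have gv0 : g v0 \is a fin_num by rewrite fin_numElt gNy.
  move: h1; rewrite -(fineK gv0) -EFinD -leeBrDr// -EFinB => /le_lt_trans; apply.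
  exact: ltry.
exists (fine (g u)); rewrite fineK//; split => // v gv gvE.
set gu := fine (g u); have guE : g u = gu%:E by rewrite fineK.
apply/ler_addgt0Pr => e e0.
have e20 : 0 < e / 2 by rewrite divr_gt0.
have [d [d0 Hd]] := Hh (v - u) (e / 2) e20.
pose E := `|mu / 2 * enorm2 (v - u)| + 1.
have E0 : 0 < E by rewrite ltr_wpDl.
have [t [t0 td t1 tE]] : exists t : R, [/\ 0 < t, t < d, t < 1 & t * E <= e / 2].
  exists (Num.min (Num.min (d / 2) 2^-1) (e / 2 / E)); split.
  - by rewrite !lt_min invr_gt0 ltr0n !divr_gt0.
  - rewrite (@le_lt_trans _ _ (d / 2))// ?ge_min ?lexx//.
    by rewrite ltr_pdivrMr// ltr_pMr// ltr1n.
  - rewrite (@le_lt_trans _ _ 2^-1)// ?ge_min ?lexx ?orbT//.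
    by rewrite invf_lt1// ltr1n.
  - by rewrite -ler_pdivlMr// ge_min lexx orbT.
have t01 : 0 < t < 1 by rewrite t0.
have td' : 0 < t < d by rewrite t0.
have := Hd t td'; rewrite ler_norml => /andP[_ h1].
have h2 := cg v u gv gu t t01 gvE guE.
have := mg (u + t *: (v - u)); rewrite guE -EFinD.
have <- : t *: v + (1 - t) *: u = u + t *: (v - u).
  by apply/matrixP => i j; rewrite !mxE; ring.
move=> /le_trans/(_ (leeD2r _ h2)); rewrite -EFinD lee_fin.
have -> : t *: v + (1 - t) *: u = u + t *: (v - u).
  by apply/matrixP => i j; rewrite !mxE; ring.
move=> h3.
have h4 : t * (mu / 2 * enorm2 (v - u)) <= e / 2.
  apply: le_trans tE; rewrite ler_wpM2l ?(ltW t0)//.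
  by rewrite (le_trans (ler_norm _))// lerDl.
have h5 : t * (t * (mu / 2 * enorm2 (v - u))) <= t * (e / 2) by rewrite ler_pM2l.
rewrite -(ler_pM2l t0) (enorm2_distC u v).
lra.
Qed.

End ExtendedConvex.

(** * Proximal and gradient steps, their fixed points and the minimizers *)

Section ForwardBackward.
Variables (R : realType) (n : nat).
Implicit Types (f : 'cV[R]_n -> R) (g : 'cV[R]_n -> \bar R).

Lemma proper_funZ (c : R) g : 0 < c -> proper_fun g -> proper_fun (fun x => (c%:E * g x)%E).
Proof.
move=> c0 [gNy [x gx]].
have gfin : g x \is a fin_num by rewrite fin_numElt gNy.
split=> [y|]; last by exists x; rewrite -(fineK gfin) -EFinM ltry.
have := gNy y; case: (g y) => [r _|_|//]; first by rewrite -EFinM ltNyr.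
by rewrite gt0_muley ?lte_fin.
Qed.

(** This is the inclusion of [w - u] in [c] times the subdifferential of [g] at [u], with the gain
    due to the modulus [mu]. *)
Lemma prox_variational (c mu : R) g w u : 0 < c -> proper_fun g -> emodconvex mu g ->
  is_prox (fun v => (c%:E * g v)%E) w u ->
  exists gu, g u = gu%:E /\ forall v gv, g v = gv%:E ->
    c * gu + c * mu / 2 * enorm2 (u - v) <= c * gv + edot (u - w) (v - u).
Proof.
move=> c0 pg cg Pu.
have [] := @minimizer_variational R n (c * mu) (fun v => (c%:E * g v)%E)
  (fun v => enorm2 (w - v) / 2) (edot (u - w)) u (proper_funZ c0 pg) (emodconvexZ c0 cg) Pu.
  move=> v e e0.
  pose E := enorm2 v / 2 + 1.
  have E0 : 0 < E by rewrite ltr_wpDl// divr_ge0// enorm2_ge0.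
  exists (e / E); split; first by rewrite divr_gt0.
  move=> t /andP[t0]; rewrite ltr_pdivlMr// => tE.
  have -> : enorm2 (w - (u + t *: v)) / 2 - enorm2 (w - u) / 2 - t * edot (u - w) v =
      t * (t * (enorm2 v / 2)).
    by rewrite !enorm2E !edotE (edotC v w) (edotC u w) (edotC v u); field.
  have v0 : 0 <= enorm2 v / 2 by rewrite divr_ge0// enorm2_ge0.
  have t0' := ltW t0; rewrite ger0_norm; last by apply: mulr_ge0 => //; exact: mulr_ge0.
  apply: ler_wpM2l => //; apply: ltW; apply: le_lt_trans tE.
  by rewrite ler_wpM2l// lerDl.
move=> gu' [guE H].
have [gu gu_eq] : exists gu, g u = gu%:E.
  case: (g u) guE => [r _|h|h]; first by exists r.
  - by rewrite gt0_muley ?lte_fin// in h.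
  - by rewrite gt0_muleNy ?lte_fin// in h.
exists gu; split => // v gv gvE.
have -> : c * gu = gu' by move: guE; rewrite gu_eq -EFinM => -[].
by apply: H; rewrite gvE EFinM.
Qed.

(** The two optimality conditions add up to [(1 + c * mu) * enorm2 (u - u') <= edot (w - w') (u -
    u')]; the square in [h3] plays the part of the Cauchy-Schwarz inequality. *)
Lemma prox_contraction (c mu : R) g w w' u u' : 0 < c -> 0 <= mu ->
  proper_fun g -> emodconvex mu g ->
  is_prox (fun v => (c%:E * g v)%E) w u -> is_prox (fun v => (c%:E * g v)%E) w' u' ->
  enorm2 (u - u') <= ((1 + c * mu) ^+ 2)^-1 * enorm2 (w - w').
Proof.
move=> c0 mu0 pg cg Pu Pu'.
have [gu [guE Hu]] := prox_variational c0 pg cg Pu.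
have [gu' [guE' Hu']] := prox_variational c0 pg cg Pu'.
have h1 := Hu _ _ guE'; have h2 := Hu' _ _ guE.
have s0 : 0 < 1 + c * mu by rewrite ltr_pwDl// mulr_ge0// ltW.
rewrite mulrC ler_pdivlMr ?exprn_gt0// mulrC.
have h3 := enorm2_ge0 ((1 + c * mu) *: (u - u') - (w - w')).
have h4 : (1 + c * mu) * enorm2 (u - u') <= edot (w - w') (u - u').
  move: h1 h2; rewrite (enorm2_distC u' u) !enorm2E !edotE.
  rewrite (edotC u' u); lra.
have h5 : (1 + c * mu) ^+ 2 * enorm2 (u - u') <=
    (1 + c * mu) * edot (w - w') (u - u') by rewrite expr2 -mulrA ler_wpM2l// ltW.
move: h3; rewrite enorm2E [edot (_ *: _ - _) _]edotDl !(edotDr, edotZl, edotZr, edotNl, edotNr).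
move: h5; rewrite !enorm2E !edotE (edotC u' u) (edotC w' w).
rewrite (edotC u w) (edotC u w') (edotC u' w) (edotC u' w').
lra.
Qed.

(** Expanding the square with monotonicity and the Lipschitz bound gives the factor
    [1 - 2 * c * nu + (c * beta)^2]; the added [(c * nu)^2] makes it visibly nonnegative. *)
Lemma gradient_step_contraction (c nu beta : R) f x y : 0 <= c -> 0 <= beta ->
  modconvex nu f -> (forall x, differentiable f x) ->
  enorm (gradient f x - gradient f y) <= beta * enorm (x - y) ->
  enorm2 ((x - c *: gradient f x) - (y - c *: gradient f y)) <=
  ((1 - c * nu) ^+ 2 + (c * beta) ^+ 2) * enorm2 (x - y).
Proof.
move=> c0 b0 cf df Lf.
have h1 := gradient_monotone cf (df x) (df y).
have h2 : enorm2 (gradient f x - gradient f y) <= beta ^+ 2 * enorm2 (x - y).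
  by rewrite -!sqr_enorm -exprMn ler_sqr ?nnegrE// ?mulr_ge0 ?sqrtr_ge0.
pose d := x - y; pose e := gradient f x - gradient f y.
have -> : x - c *: gradient f x - (y - c *: gradient f y) = d - c *: e.
  by apply/matrixP => i j; rewrite !mxE; ring.
rewrite -/d -/e in h1 h2 *; move: d e h1 h2 => d e h1 h2.
have -> : enorm2 (d - c *: e) = enorm2 d - 2 * c * edot e d + c ^+ 2 * enorm2 e.
  by rewrite !enorm2E !edotE (edotC d e); ring.
have h3 : c * (nu * enorm2 d) <= c * edot e d by rewrite ler_wpM2l.
have h4 : c ^+ 2 * enorm2 e <= c ^+ 2 * (beta ^+ 2 * enorm2 d).
  by rewrite ler_wpM2l// exprn_ge0.
have h5 : 0 <= (c * nu) ^+ 2 * enorm2 d by rewrite mulr_ge0 ?sqr_ge0 ?enorm2_ge0.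
nra.
Qed.

(** At a fixed point the optimality condition of the prox says that minus the gradient of [f] is a
    subgradient of [g] at [u]. *)
Lemma fixed_point_minimizer (c mu : R) f g u : 0 < c -> 0 <= mu ->
  modconvex 0 f -> (forall x, differentiable f x) ->
  proper_fun g -> emodconvex mu g ->
  is_prox (fun v => (c%:E * g v)%E) (u - c *: gradient f u) u -> is_minimizer f g u.
Proof.
move=> c0 mu0 cf df pg cg Pu y.
have [gu [guE H]] := prox_variational c0 pg cg Pu.
have h1 := modconvex_first_order y cf (df u).
rewrite !mul0r addr0 in h1.
have [gNy _] := pg; have := gNy y.
case gyE : (g y) => [gy|//|//] _; last by rewrite addey// leey.
rewrite guE -!EFinD lee_fin -(ler_pM2l c0).
have := H _ _ gyE.
have -> : edot (u - (u - c *: gradient f u)) (y - u) = c * edot (gradient f u) (y - u).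
  by rewrite opprB addrCA subrr addr0 edotZl.
have : 0 <= c * mu / 2 * enorm2 (u - y).
  by rewrite mulr_ge0 ?enorm2_ge0// divr_ge0// mulr_ge0// ltW.
have : c * (f u + edot (gradient f u) (y - u)) <= c * f y by rewrite ler_pM2l.
lra.
Qed.

(** Both optimality conditions and the monotonicity of the gradient add up to
    [(mu + nu) * enorm2 (x - y) <= 0]. *)
Lemma minimizer_unique (mu nu : R) f g x y : 0 < mu + nu ->
  modconvex nu f -> (forall x, differentiable f x) ->
  proper_fun g -> emodconvex mu g ->
  is_minimizer f g x -> is_minimizer f g y -> x = y.
Proof.
move=> mn cf df pg cg mx my.
have V u : is_minimizer f g u -> exists gu, g u = gu%:E /\ forall v gv, g v = gv%:E ->
    gu + mu / 2 * enorm2 (u - v) <= gv + edot (gradient f u) (v - u).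
  move=> mu'; apply: (@minimizer_variational R n mu g f (edot (gradient f u)) u) => //.
    by move=> v; rewrite addeC [leRHS]addeC; exact: mu'.
  by move=> v e e0; exact: gradient_ray.
have [gx [gxE Hx]] := V x mx; have [gy [gyE Hy]] := V y my.
have := Hx _ _ gyE; have := Hy _ _ gxE.
have := gradient_monotone cf (df x) (df y).
rewrite (enorm2_distC y x) => h1 h2 h3.
apply/eqP; rewrite -subr_eq0; apply/eqP; apply: enorm2_eq0.
rewrite -(ler_pM2l mn) mulr0.
move: h1 h2 h3; rewrite !edotE; lra.
Qed.

(** The contraction is Euclidean, but Banach's theorem is applied in the max norm: the [k]-th
    iterate halves max norm distances once [q ^+ k * n%:R <= 1 / 4]. *)
Lemma contraction_fixed_point (q : R) (Phi : 'cV[R]_n -> 'cV[R]_n) : 0 <= q < 1 ->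
  (forall x y, enorm2 (Phi x - Phi y) <= q * enorm2 (x - y)) -> exists x, Phi x = x.
Proof.
move=> /andP[q0 q1] HPhi.
have [k Hk] : exists k, q ^+ k * n%:R <= (2^-1) ^+ 2.
  have n1 : 0 < n%:R + 1 :> R by rewrite ltr_wpDl.
  have /cvg_seqP/(_ ((2^-1) ^+ 2 / (n%:R + 1)))[|k Hk] : GRing.exp q @ \oo --> (0 : R).
  - by apply: cvg_expr; rewrite ger0_norm.
  - by rewrite divr_gt0// exprn_gt0// invr_gt0.
  exists k; have := Hk k (leqnn _); rewrite subr0 ger0_norm ?exprn_ge0//.
  rewrite ler_pdivlMr//; apply: le_trans.
  by rewrite ler_wpM2l ?exprn_ge0// lerDl.
pose Psi := iter k Phi.
have HPsi x y : `|Psi x - Psi y| <= 2^-1 * `|x - y|.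
  have H j : enorm2 (iter j Phi x - iter j Phi y) <= q ^+ j * enorm2 (x - y).
    elim: j => [|j IH]; first by rewrite mul1r.
    by rewrite /= (le_trans (HPhi _ _))// exprS -mulrA ler_wpM2l.
  rewrite -ler_sqr ?nnegrE// ?mulr_ge0 ?invr_ge0//.
  apply: le_trans (sqr_norm_le_enorm2 _) (le_trans (H k) _).
  apply: le_trans (ler_wpM2l _ (enorm2_le_sqr_norm _)) _; first by rewrite exprn_ge0.
  by rewrite exprMn mulrA ler_wpM2r ?exprn_ge0.
have half0 : 0 <= 2^-1 :> R by rewrite invr_ge0.
have [||p _ pE] := @banach_fixed_point R 'cV[R]_n setT
    [the {fun setT >-> setT} of totalfun Psi] _ closedT _.
- exists (NngNum half0); split => /=; first by rewrite invf_lt1 ?ltr1n.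
  by move=> [x y] _ /=; exact: HPsi.
- by exists 0.
have {}pE : p = Psi p := pE.
exists p; apply/eqP; rewrite -subr_eq0 -normr_le0.
(* [Phi p] is again a fixed point of the iterate, hence equal to [p]. *)
have := HPsi (Phi p) p.
by rewrite -pE /Psi -iterSr iterS -/Psi -pE; lra.
Qed.

End ForwardBackward.

(** * Euclidean bounds on Clarke Jacobians *)

Section ClarkeBounds.
Variables (R : realType) (N m : nat).

(** Euclidean balls are closed and convex, so a bound on difference quotients passes to Jacobians,
    their limits and convex combinations. The affine form serves [T] with [c = 1], [b = 0] and the
    gradient step with [c = - gamma], [b = v]. *)
Lemma clarke_dir_bound (D : set 'cV[R]_N) (f : 'cV[R]_N -> 'cV[R]_m) z v c b s M :
  open D -> D z ->
  (forall y t, D y -> 0 < t ->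
     enorm2 (c *: (t^-1 *: (f (y + t *: v) - f y)) + b) <= s) ->
  clarke_jac f z M -> enorm2 (c *: (M *m v) + b) <= s.
Proof.
move=> oD Dz Hs [k [w [Ms [w0 [w1 [HMs ->]]]]]].
have lim_le (u : nat -> 'cV[R]_m) l k0 : u @ \oo --> l ->
    (forall i, (k0 <= i)%N -> enorm2 (u i) <= s) -> enorm2 l <= s.
  move=> /enorm2_cvg ul us; rewrite -(cvg_lim _ ul)//.
  by apply: limr_le; [apply/cvg_ex; exists (enorm2 l)|exists k0].
have affine_cvg (u : nat -> 'cV[R]_m) l : u @ \oo --> l ->
    (fun i => c *: u i + b) @ \oo --> c *: l + b.
  by move=> ul; apply: cvgD; [apply: cvgZr|exact: cvg_cst].
have -> : c *: ((\sum_i w i *: Ms i) *m v) + b = \sum_i w i *: (c *: (Ms i *m v) + b).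
  under [RHS]eq_bigr do rewrite scalerDr.
  rewrite big_split/= -scaler_suml w1 scale1r mulmx_suml scaler_sumr; congr (_ + _).
  by apply: eq_bigr => i _; rewrite -scalemxAl !scalerA mulrC.
apply: enorm2_conv_le => // i.
have [zs [Js [zsz [HJ JM]]]] := HMs i.
have [r [r0 Hr]] := open_ball_sub oD Dz.
have /cvg_seqP/(_ (r / 2))[|k0 Hk0] := zsz; first by rewrite divr_gt0.
apply: (lim_le (fun j => c *: (Js j *m v) + b) _ k0).
  by apply: affine_cvg; apply: cvg_mulmx => //; exact: cvg_cst.
move=> j /Hk0 Hj.
have Dj : D (zs j).
  by apply: Hr; apply: le_lt_trans Hj _; rewrite ltr_pdivrMr// ltr_pMr// ltr1n.
apply: (lim_le _ _ 0%N (affine_cvg _ _ (@has_jac_cvg _ _ _ _ _ _ v (HJ j)))) => l _.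
have := Hs (zs j) l.+1%:R^-1 Dj; rewrite invrK; apply.
by rewrite invr_gt0.
Qed.

End ClarkeBounds.

(** * Absolutely continuous curves and their images *)

Section AbsoluteContinuity.
Variable R : realType.

Lemma abs_cont_unif N (c : R -> 'cV[R]_N) : abs_cont_curve 0 1 c ->
  forall e, 0 < e -> exists d : R, 0 < d /\ forall s t, 0 <= s <= 1 -> 0 <= t <= 1 ->
    `|s - t| < d -> `|c s - c t| < e.
Proof.
move=> ac e e0; have [d [d0 Hd]] := ac e e0.
have le_case s t : 0 <= s <= 1 -> 0 <= t <= 1 -> s <= t -> `|s - t| < d -> `|c t - c s| < e.
  move=> /andP[s0 s1] /andP[t0 t1] st std.
  have := Hd 1%N (fun=> s) (fun=> t); rewrite !big_ord1; apply => //.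
    by move=> i j; rewrite !ord1 eqxx.
  by move: std; rewrite distrC ger0_norm ?subr_ge0.
exists d; split => // s t s01 t01 std.
have [st|/ltW ts] := leP s t; first by rewrite distrC; exact: le_case.
by apply: le_case => //; rewrite distrC.
Qed.

(** Gives the absolute continuity of stacked curves and of the gradient step along a curve. *)
Lemma abs_cont_dominated N1 N2 N3 (c : R -> 'cV[R]_N3) (c1 : R -> 'cV[R]_N1)
    (c2 : R -> 'cV[R]_N2) (B : R) : 0 <= B ->
  abs_cont_curve 0 1 c1 -> abs_cont_curve 0 1 c2 ->
  (forall s t, 0 <= s <= 1 -> 0 <= t <= 1 ->
     `|c s - c t| <= `|c1 s - c1 t| + B * `|c2 s - c2 t|) ->
  abs_cont_curve 0 1 c.
Proof.
move=> B0 ac1 ac2 H e e0.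
have B1 : 0 < B + 1 by rewrite ltr_wpDl.
have [|d1 [d10 H1]] := ac1 (e / 2); first by rewrite divr_gt0.
have [|d2 [d20 H2]] := ac2 (e / 2 / (B + 1)); first by rewrite !divr_gt0.
exists (Num.min d1 d2); split; first by rewrite lt_min d10.
move=> k l u lu dis; rewrite lt_min => /andP[/(H1 k l u lu dis) h1 /(H2 k l u lu dis)].
rewrite ltr_pdivlMr// => h2.
rewrite (splitr e); apply: le_lt_trans (ltrD h1 h2).
rewrite mulr_suml -big_split/=; apply: ler_sum => i _.
have [li [liu ui]] := lu i.
have l01 : 0 <= l i <= 1 by rewrite li (le_trans liu).
have u01 : 0 <= u i <= 1 by rewrite ui (le_trans li).
apply: le_trans (H _ _ u01 l01) _.
by rewrite lerD2l mulrC ler_wpM2l// lerDl.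
Qed.

(** By compactness of [[0, 1]] one Lipschitz constant serves all pairs of nearby parameters:
    otherwise failing pairs would accumulate at some parameter, against the local Lipschitz bound at
    its image. *)
Lemma abs_cont_comp N m (D : set 'cV[R]_N) (f : 'cV[R]_N -> 'cV[R]_m) c :
  open D -> loc_lipschitz_on D f -> abs_cont_curve 0 1 c ->
  (forall t, 0 <= t <= 1 -> D (c t)) -> abs_cont_curve 0 1 (f \o c).
Proof.
move=> oD lf ac cD.
have [r [K [r0 K0 HK]]] : exists r K : R, [/\ 0 < r, 0 <= K & forall s t,
    0 <= s <= 1 -> 0 <= t <= 1 -> `|s - t| < r -> `|f (c s) - f (c t)| <= K * `|c s - c t|].
  apply: contrapT => nH.
  have /choice[st Hst] : forall k : nat, exists st : R * R,
      [/\ 0 <= st.1 <= 1, 0 <= st.2 <= 1, `|st.1 - st.2| < k.+1%:R^-1 &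
        k%:R * `|c st.1 - c st.2| < `|f (c st.1) - f (c st.2)|].
    move=> k; apply: contrapT => nk; apply: nH; exists k.+1%:R^-1, k%:R.
    split => // s t s01 t01 stk; rewrite leNgt; apply/negP => h.
    by apply: nk; exists (s, t).
  have [|j [ji [l Hl]]] := @bounded_family_subseq R unit (fun k _ => (st k).1) 1.
    by move=> k _; have [/andP[s0 s1] _ _ _] := Hst k; rewrite ger0_norm.
  have {}Hl := Hl tt.
  have l01 : 0 <= l tt <= 1.
    rewrite -(cvg_lim _ Hl)//; apply/andP; split.
      apply: limr_ge; first by apply/cvg_ex; exists (l tt).
      by apply: nearW => k; have [/andP[]] := Hst (j k).
    apply: limr_le; first by apply/cvg_ex; exists (l tt).
    by apply: nearW => k; have [/andP[]] := Hst (j k).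
  have [r [K [r0 K0 _ HK]]] := loc_lipschitz_ball oD lf (cD _ l01).
  have [d [d0 Hd]] := abs_cont_unif ac r0.
  have d20 : 0 < d / 2 by rewrite divr_gt0.
  have /cvg_seqP/(_ _ d20)[k0 Hk0] := Hl.
  (* Beyond these thresholds both parameters are within [d] of the limit and [K <= (j k)%:R]. *)
  pose k := maxn k0 (maxn (Num.truncn (d / 2)^-1) (Num.truncn K).+1).
  have jk : (k <= j k)%N.
    elim: k => // i /leq_ltn_trans; apply.
    by move/increasing_seqP: ji; exact.
  have [s01 t01 stk hk] := Hst (j k).
  have h1 : `|(st (j k)).1 - l tt| <= d / 2 by apply: Hk0; rewrite leq_maxl.
  have h2 : `|(st (j k)).1 - (st (j k)).2| < d / 2.
    apply: lt_le_trans stk _; rewrite invf_ple ?posrE//; apply: ltW.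
    apply: (lt_le_trans (Num.Theory.truncnS_gt _)); rewrite ler_nat ltnS.
    by rewrite (leq_trans _ jk)// !leq_max leqnn !orbT.
  have dd : d / 2 < d by rewrite ltr_pdivrMr// ltr_pMr// ltr1n.
  have Kk : K <= (j k)%:R.
    apply: ltW; apply: (lt_le_trans (Num.Theory.truncnS_gt _)); rewrite ler_nat.
    by rewrite (leq_trans _ jk)// !leq_max leqnn !orbT.
  move: hk; rewrite ltNge => /negP; apply.
  apply: le_trans (HK _ _ _ _) _.
  - by apply: Hd => //; exact: le_lt_trans dd.
  - apply: Hd => //; rewrite -(subrKA (st (j k)).1) (splitr d).
    by rewrite (le_lt_trans (ler_normD _ _))// ltr_leD// distrC.
  - by rewrite ler_wpM2r.
move=> e e0; have K1 : 0 < K + 1 by rewrite ltr_wpDl.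
have [|d [d0 Hd]] := ac (e / (K + 1)); first by rewrite divr_gt0.
exists (Num.min d r); split; first by rewrite lt_min d0.
move=> k l u lu dis; rewrite lt_min => /andP[sd sr].
have := Hd k l u lu dis sd; rewrite ltr_pdivlMr//; apply: le_lt_trans.
rewrite mulr_suml; apply: ler_sum => i _ /=.
have [li [liu ui]] := lu i.
have l01 : 0 <= l i <= 1 by rewrite li (le_trans liu).
have u01 : 0 <= u i <= 1 by rewrite ui (le_trans li).
apply: le_trans (HK _ _ u01 l01 _) _.
  rewrite ger0_norm ?subr_ge0//; apply: le_lt_trans sr.
  rewrite (bigD1 i)//= lerDl; apply: sumr_ge0 => a _.
  by have [_ [? _]] := lu a; rewrite subr_ge0.
by rewrite mulrC ler_wpM2l// lerDl.
Qed.

End AbsoluteContinuity.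

(** * Implicit differentiation of a fixed point *)

Section CurveDerivatives.
Variable R : realType.

Lemma derive1_submx N N' (s : 'cV[R]_N -> 'cV[R]_N') (c : R -> 'cV[R]_N) t :
  (forall x, `|s x| <= `|x|) -> (forall x y, s (x - y) = s x - s y) ->
  (forall a x, s (a *: x) = a *: s x) ->
  derivable c t 1 -> derivable (s \o c) t 1 /\ derive1 (s \o c) t = s (derive1 c t).
Proof.
move=> sn sB sZ dc; apply/derivable1_epsP => e e0.
have /derivable1_epsP/(_ e e0)[d [d0 Hd]] := conj dc (erefl (derive1 c t)).
exists d; split => // h /Hd; apply: le_trans.
by rewrite /= -sZ -!sB.
Qed.

Lemma derive1_usubmx N1 N2 (c : R -> 'cV[R]_(N1 + N2)) t : derivable c t 1 ->
  derivable (fun s => usubmx (c s)) t 1 /\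
  derive1 (fun s => usubmx (c s)) t = usubmx (derive1 c t).
Proof.
apply: (@derive1_submx _ _ (@usubmx _ N1 N2 1)) => [x|x y|a x].
- exact: norm_usubmx_le.
- by rewrite linearB.
- by rewrite linearZ.
Qed.

Lemma derive1_dsubmx N1 N2 (c : R -> 'cV[R]_(N1 + N2)) t : derivable c t 1 ->
  derivable (fun s => dsubmx (c s)) t 1 /\
  derive1 (fun s => dsubmx (c s)) t = dsubmx (derive1 c t).
Proof.
apply: (@derive1_submx _ _ (@dsubmx _ N1 N2 1)) => [x|x y|a x].
- exact: norm_dsubmx_le.
- by rewrite linearB.
- by rewrite linearZ.
Qed.

Lemma derive1_eq_unit_interval N (c1 c2 : R -> 'cV[R]_N) t : 0 < t < 1 ->
  (forall s, 0 <= s <= 1 -> c1 s = c2 s) -> derivable c1 t 1 ->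
  derivable c2 t 1 /\ derive1 c2 t = derive1 c1 t.
Proof.
move=> /andP[t0 t1] H dc; apply/derivable1_epsP => e e0.
have /derivable1_epsP/(_ e e0)[d [d0 Hd]] := conj dc (erefl (derive1 c1 t)).
exists (Num.min d (Num.min t (1 - t))); split.
  by rewrite !lt_min d0 t0 subr_gt0.
move=> h; rewrite !lt_min => /and3P[hd]; rewrite !ltr_norml.
move=> /andP[h1 _] /andP[_ h2].
rewrite -!H; first exact: Hd; first lra.
by apply/andP; split; lra.
Qed.

Lemma negligible_set1 (a : R) : (@lebesgue_measure R).-negligible [set a].
Proof. by exists [set a]; split => //; exact: lebesgue_measure_set1. Qed.

Lemma norm_col_mx_sub N1 N2 (a a' : 'cV[R]_N1) (b b' : 'cV[R]_N2) :
  `|col_mx a b - col_mx a' b'| <= `|a - a'| + `|b - b'|.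
Proof.
by rewrite opp_col_mx add_col_mx norm_col_mx_le// ?lerDl ?lerDr.
Qed.

Lemma seq_continuous_eps N m (D : set 'cV[R]_N) (g : 'cV[R]_N -> 'cV[R]_m) z :
  (forall u : nat -> 'cV[R]_N, (forall k, D (u k)) -> u @ \oo --> z ->
     (fun k => g (u k)) @ \oo --> g z) ->
  forall e : R, 0 < e -> exists d : R, 0 < d /\
    forall y, D y -> `|y - z| < d -> `|g y - g z| < e.
Proof.
move=> H e e0; apply: contrapT => nH.
have [|u [_ [uz Hu]]] := @exists_seq_cvg R 'cV[R]_N unit
    (fun y _ => D y /\ ~ (`|g y - g z| < e)) z.
  move=> d d0; apply: contrapT => nd; apply: nH; exists d; split => // y Dy yd.
  by apply: contrapT => h; apply: nd; exists y, tt; split; [exact: ltW|].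
have e20 : 0 < e / 2 by rewrite divr_gt0.
have /cvg_seqP/(_ _ e20)[k0 Hk0] := H u (fun k => (Hu k).1) uz.
have [_] := Hu k0; apply; apply: le_lt_trans (Hk0 k0 (leqnn _)) _.
by rewrite ltr_pdivrMr// ltr_pMr// ltr1n.
Qed.

End CurveDerivatives.

(** The hypothesis is the fixed point equation differentiated along a curve, with [c] and [x] the
    velocities of the parameter and of the solution. *)
Lemma resolvent_eq (R : realType) p n (gamma : R) (U W : 'M[R]_(n, p)) (V Z : 'M[R]_n)
    (c : 'cV[R]_p) (x : 'cV[R]_n) :
  x = U *m c + V *m (x - gamma *: (W *m c + Z *m x)) ->
  (1%:M - V *m (1%:M - gamma *: Z)) *m x = (U - gamma *: (V *m W)) *m c.
Proof.
move=> xE; have QE : (1%:M - gamma *: Z) *m x = x - gamma *: (Z *m x).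
  by rewrite mulmxBl mul1mx scalemxAl.
rewrite mulmxBl mul1mx -mulmxA QE mulmxBl -scalemxAl -mulmxA.
set Q := V *m (x - gamma *: (Z *m x)).
have VE : V *m (x - gamma *: (W *m c + Z *m x)) = Q - gamma *: (V *m (W *m c)).
  by rewrite /Q (scalemxAr gamma V (W *m c)) -mulmxBr scalerDr opprD addrA addrAC.
by rewrite {1}xE VE [Q - _]addrC addrA addrK.
Qed.

(** * An abstract forward-backward map: [H] stands for the joint gradient, [w] for the gradient
    step, [a] and [b] for squared contraction factors *)

Section ImplicitFixedPoint.
Variables (R : realType) (p n : nat) (Theta : set 'cV[R]_p).
Variables (T H : 'cV[R]_(p + n) -> 'cV[R]_n) (gamma a b : R).
Variables (xs w : 'cV[R]_p -> 'cV[R]_n).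
Let D := [set z : 'cV[R]_(p + n) | Theta (usubmx z)].
Hypotheses (oTheta : open Theta) (gamma0 : 0 < gamma).
Hypotheses (a0 : 0 <= a) (b0 : 0 <= b) (ab1 : a * b < 1).
Hypothesis T_contr : forall th x y, Theta th ->
  enorm2 (T (col_mx th x) - T (col_mx th y)) <= a * enorm2 (x - y).
Hypothesis H_contr : forall th x y, Theta th ->
  enorm2 ((x - gamma *: H (col_mx th x)) - (y - gamma *: H (col_mx th y))) <=
  b * enorm2 (x - y).
Hypotheses (pT : path_diff_on D T) (pH : path_diff_on D H).
Hypothesis wE : forall th, w th = xs th - gamma *: H (col_mx th (xs th)).
Hypothesis xsE : forall th, Theta th -> T (col_mx th (w th)) = xs th.

Let oD : open D.
Proof.
rewrite openE => z Dz; apply/(@nbhs_epsP R 'cV[R]_(p + n)).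
have [r [r0 Hr]] := open_ball_sub oTheta Dz.
exists r; split => // y yz; apply: Hr; rewrite -linearB.
exact: le_lt_trans (norm_usubmx_le _) yz.
Qed.

Let Dcol th x : Theta th -> D (col_mx th x).
Proof. by rewrite /D /= col_mxKu. Qed.

Let translate (y : 'cV[R]_(p + n)) (t : R) (v : 'cV[R]_n) :
  y + t *: col_mx 0 v = col_mx (usubmx y) (dsubmx y + t *: v).
Proof. by rewrite -{1}[y]vsubmxK scale_col_mx scaler0 add_col_mx addr0. Qed.

Let mul_block (A : 'M[R]_(n, p + n)) (v : 'cV[R]_n) : A *m col_mx 0 v = rsubmx A *m v.
Proof. by rewrite -{1}[A]hsubmxK mul_row_col mulmx0 add0r. Qed.

(** Both steps satisfy their bound in [x] at every fixed parameter, and translations along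
    [col_mx 0 v] stay in [D]; the bounds on these difference quotients pass to the right-hand blocks
    of the joint Clarke Jacobians. *)
Lemma clarke_contraction th A B (v : 'cV[R]_n) : Theta th ->
  clarke_jac T (col_mx th (w th)) A -> clarke_jac H (col_mx th (xs th)) B ->
  enorm2 (rsubmx A *m ((1%:M - gamma *: rsubmx B) *m v)) <= a * b * enorm2 v.
Proof.
move=> Tth HA HB; set u := _ *m v.
have hA : enorm2 (rsubmx A *m u) <= a * enorm2 u.
  rewrite -mul_block -[X in enorm2 X]scale1r -[X in enorm2 X]addr0.
  apply: (@clarke_dir_bound R _ _ D T _ _ _ _ _ _ oD (Dcol _ Tth) _ HA).
  move=> y t Dy t0; rewrite addr0 scale1r translate -{3}[y]vsubmxK enorm2Z.
  apply: le_trans (ler_wpM2l _ (T_contr _ _ Dy)) _; first by rewrite exprn_ge0// invr_ge0 ltW.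
  rewrite addrAC subrr add0r enorm2Z mulrCA (mulrA (t^-1 ^+ 2)) -exprMn.
  by rewrite mulVf ?expr1n ?mul1r// gt_eqF.
have hB : enorm2 u <= b * enorm2 v.
  have -> : u = - gamma *: (B *m col_mx 0 v) + v.
    by rewrite mul_block /u mulmxBl mul1mx -scalemxAl scaleNr addrC.
  apply: (@clarke_dir_bound R _ _ D H _ _ _ _ _ _ oD (Dcol _ Tth) _ HB).
  move=> y t Dy t0; rewrite translate -{3}[y]vsubmxK.
  set x := dsubmx y; set th' := usubmx y.
  have -> : - gamma *: (t^-1 *: (H (col_mx th' (x + t *: v)) - H (col_mx th' x))) + v =
      t^-1 *: ((x + t *: v - gamma *: H (col_mx th' (x + t *: v))) -
               (x - gamma *: H (col_mx th' x))).
    apply/matrixP => i j; rewrite !mxE; field.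
    by rewrite gt_eqF.
  rewrite enorm2Z.
  apply: le_trans (ler_wpM2l _ (H_contr _ _ Dy)) _; first by rewrite exprn_ge0// invr_ge0 ltW.
  rewrite addrAC subrr add0r enorm2Z mulrCA (mulrA (t^-1 ^+ 2)) -exprMn.
  by rewrite mulVf ?expr1n ?mul1r// gt_eqF.
by apply: le_trans hA _; rewrite -mulrA ler_wpM2l.
Qed.

Let resolvent (A B : 'M[R]_(n, p + n)) : 'M[R]_n :=
  1%:M - rsubmx A *m (1%:M - gamma *: rsubmx B).
Let rhs (A B : 'M[R]_(n, p + n)) : 'M[R]_(n, p) :=
  lsubmx A - gamma *: (rsubmx A *m lsubmx B).

(** A kernel vector is reproduced by a strict contraction, hence zero. The transpose appears because
    [det0P] yields row vectors. *)
Lemma resolvent_unit th A B : Theta th ->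
  clarke_jac T (col_mx th (w th)) A -> clarke_jac H (col_mx th (xs th)) B ->
  resolvent A B \in unitmx.
Proof.
move=> Tth HA HB; rewrite unitmxE unitfE -det_tr; apply/det0P => -[v v0 vA].
move/eqP: v0; apply; apply: trmx_inj; rewrite trmx0.
have vE : v^T = rsubmx A *m ((1%:M - gamma *: rsubmx B) *m v^T).
  apply/eqP; rewrite -subr_eq0 mulmxA -{1}[v^T]mul1mx -mulmxBl -/(resolvent A B).
  by rewrite -[_ *m _]trmxK trmx_mul trmxK vA trmx0.
apply: enorm2_eq0.
have := clarke_contraction v^T Tth HA HB; rewrite -vE.
have := enorm2_ge0 v^T; set e := enorm2 _ => e0 h.
rewrite leNgt; apply/negP => e1.
have : a * b * e < e by rewrite gtr_pMl.
by rewrite ltNge h.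
Qed.

Let Jxs (th : 'cV[R]_p) : set 'M[R]_(n, p) :=
  [set M | exists (U : 'M[R]_(n, p)) (V : 'M[R]_n) (W : 'M[R]_(n, p)) (Z : 'M[R]_n),
     clarke_jac T (col_mx th (w th)) (row_mx U V) /\
     clarke_jac H (col_mx th (xs th)) (row_mx W Z) /\
     M = invmx (1%:M - V *m (1%:M - gamma *: Z)) *m (U - gamma *: (V *m W))].

Let JxsP th M : Theta th -> Jxs th M <-> exists A B,
  [/\ clarke_jac T (col_mx th (w th)) A, clarke_jac H (col_mx th (xs th)) B &
      resolvent A B *m M = rhs A B].
Proof.
move=> Tth; split=> [[U [V [W [Z [HA [HB ->]]]]]]|[A [B [HA HB E]]]].
  exists (row_mx U V), (row_mx W Z); split => //.
  have := resolvent_unit Tth HA HB; rewrite /resolvent /rhs !row_mxKl !row_mxKr => uA.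
  by rewrite mulKVmx.
exists (lsubmx A), (rsubmx A), (lsubmx B), (rsubmx B); rewrite !hsubmxK.
split => //; split => //; rewrite -/(rhs A B) -E mulKmx//.
exact: resolvent_unit HA HB.
Qed.

Let absorb : exists K : R, 0 <= K /\ forall d x c : 'cV[R]_n,
  d = x + c -> enorm2 x <= a * b * enorm2 d -> `|d| <= K * `|c|.
Proof. by apply: contraction_absorb; rewrite mulr_ge0. Qed.

(** The difference splits at the image of [xs th] under the map of parameter [th']: one part is
    contracted and absorbed, the other compares two parameters at the same point [xs th]. *)
Let fixed_point_dist : exists K : R, 0 <= K /\ forall th th', Theta th -> Theta th' ->
  `|xs th - xs th'| <=
  K * `|T (col_mx th (w th)) - T (col_mx th' (xs th - gamma *: H (col_mx th' (xs th))))|.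
Proof.
have [K [K0 HK]] := absorb; exists K; split => // th th' Tth Tth'.
apply: (HK _ (T (col_mx th' (xs th - gamma *: H (col_mx th' (xs th)))) -
              T (col_mx th' (w th')))).
  by rewrite [RHS]addrC subrKA !xsE.
rewrite wE -mulrA (le_trans (T_contr _ _ Tth'))//.
by rewrite ler_wpM2l// H_contr.
Qed.

(** The local constants of [T] and [H] apply only once [xs th] is known to be near [x0]. Comparison
    with [th0], where the point is frozen at [x0], gives this nearness; two arbitrary parameters can
    then be compared. *)
Lemma fixed_point_loc_lipschitz : loc_lipschitz_on Theta xs.
Proof.
move=> th0 Tth0; have [K [K0 HK]] := fixed_point_dist.
have [lT _] := pT; have [lH _] := pH.
set x0 := xs th0; set w0 := w th0.
have [r1 [K1 [r10 K10 _ H1]]] := loc_lipschitz_ball oD lH (Dcol x0 Tth0).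
have [r2 [K2 [r20 K20 _ H2]]] := loc_lipschitz_ball oD lT (Dcol w0 Tth0).
have gK : 0 <= gamma * K1 by rewrite mulr_ge0// ltW.
pose C := K * (K2 * (1 + gamma * K1)).
have C0 : 0 <= C by rewrite !mulr_ge0// addr_ge0.
(* At least as large as each factor by which the distances in [near_r] exceed the parameter
   distance; it determines the radius [e]. *)
pose M := (1 + C) * (1 + gamma * K1).
have M1 : 1 + C + gamma * K1 <= M.
  by rewrite /M mulrDr mulr1 lerD2l mulrDl mul1r lerDl mulr_ge0.
have M0 : 0 < M by apply: lt_le_trans M1; rewrite -addrA ltr_pwDl// addr_ge0.
pose e := Num.min r1 r2 / M.
have e0 : 0 < e by rewrite divr_gt0// lt_min r10.
have near_r s : 0 <= s -> s < e -> [/\ (1 + C) * s < r1, (1 + C) * s < r2,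
    (1 + gamma * K1) * s < r2 & (1 + C) * s + gamma * K1 * ((1 + C) * s) < r2].
  move=> s0; rewrite /e ltr_pdivlMr// lt_min => /andP[h1 h2].
  have hC : (1 + C) * s <= s * M.
    by rewrite [leRHS]mulrC ler_wpM2r//; apply: le_trans M1; rewrite lerDl.
  have hK : (1 + gamma * K1) * s <= s * M.
    rewrite [leRHS]mulrC ler_wpM2r//; apply: le_trans M1.
    by rewrite addrAC lerDl.
  split; [exact: le_lt_trans h1|exact: le_lt_trans h2|exact: le_lt_trans h2|].
  apply: le_lt_trans h2; rewrite /M le_eqVlt; apply/orP; left; apply/eqP; ring.
have step th th' x : `|col_mx th x - col_mx th0 x0| < r1 ->
    `|col_mx th' x - col_mx th0 x0| < r1 ->
    `|col_mx th (x - gamma *: H (col_mx th x)) - col_mx th0 w0| < r2 ->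
    `|col_mx th' (x - gamma *: H (col_mx th' x)) - col_mx th0 w0| < r2 ->
    `|T (col_mx th (x - gamma *: H (col_mx th x))) -
      T (col_mx th' (x - gamma *: H (col_mx th' x)))| <=
    K2 * ((1 + gamma * K1) * `|th - th'|).
  move=> h1 h2 h3 h4; apply: le_trans (H2 _ _ h3 h4) _; rewrite ler_wpM2l//.
  apply: le_trans (norm_col_mx_sub _ _ _ _) _; rewrite mulrDl mul1r lerD2l.
  rewrite opprD addrACA subrr add0r -opprD normrN -scalerBr normrZ gtr0_norm//.
  rewrite -mulrA ler_wpM2l ?(ltW gamma0)//; apply: le_trans (H1 _ _ h1 h2) _.
  rewrite ler_wpM2l//; apply: le_trans (norm_col_mx_sub _ _ _ _) _.
  by rewrite subrr normr0 addr0.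
have w_dist th x : `|col_mx th x - col_mx th0 x0| < r1 ->
    `|x - gamma *: H (col_mx th x) - w0| <=
    `|x - x0| + gamma * K1 * `|col_mx th x - col_mx th0 x0|.
  move=> h1; rewrite /w0 wE -/x0.
  have -> : x - gamma *: H (col_mx th x) - (x0 - gamma *: H (col_mx th0 x0)) =
      (x - x0) - gamma *: (H (col_mx th x) - H (col_mx th0 x0)).
    by apply/matrixP => i j; rewrite !mxE; ring.
  rewrite (le_trans (ler_normB _ _))// lerD2l normrZ gtr0_norm// -mulrA.
  rewrite ler_wpM2l ?(ltW gamma0)//; apply: H1 => //.
  by rewrite subrr normr0.
have C1 s : 0 <= s -> s <= (1 + C) * s by move=> s0; rewrite ler_peMl// lerDl.
have center th : Theta th -> `|th - th0| < e -> `|xs th - x0| <= C * `|th - th0|.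
  move=> Tth the; have [h1 h2 h3 h4] := near_r _ (normr_ge0 _) the.
  have hth : `|col_mx th x0 - col_mx th0 x0| <= `|th - th0|.
    by apply: le_trans (norm_col_mx_sub _ _ _ _) _; rewrite subrr normr0 addr0.
  have hr1 : `|col_mx th x0 - col_mx th0 x0| < r1.
    exact: le_lt_trans (le_trans hth (C1 _ (normr_ge0 _))) h1.
  (* Taking [th0] as first parameter freezes the point at [x0]. *)
  rewrite distrC (le_trans (HK _ _ Tth0 Tth))// /C -!mulrA ler_wpM2l//.
  rewrite wE -/x0 (distrC th); apply: step => //.
  - by rewrite subrr normr0.
  - by rewrite [X in `|X|](_ : _ = 0) ?normr0// /w0 wE -/x0 subrr.
  - apply: le_lt_trans (norm_col_mx_sub _ _ _ _) _; apply: le_lt_trans h3.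
    rewrite mulrDl mul1r lerD2l (le_trans (w_dist _ _ hr1))// subrr normr0 add0r.
    by rewrite ler_wpM2l.
exists e, C; split => // th th' Tth Tth'; rewrite -ball_normE/= => the the'.
rewrite distrC in the; rewrite distrC in the'.
pose s := Num.max `|th - th0| `|th' - th0|.
have s0 : 0 <= s by rewrite le_max normr_ge0.
have se : s < e by rewrite gt_max the.
have [h1 h2 h3 h4] := near_r _ s0 se.
have near_x t : `|t - th0| <= s ->
    `|col_mx t (xs th) - col_mx th0 x0| <= (1 + C) * s.
  move=> ts; apply: le_trans (norm_col_mx_sub _ _ _ _) _.
  rewrite mulrDl mul1r lerD// (le_trans (center _ Tth the))// ler_wpM2l//.
  by rewrite le_max lexx.
have near_w t : `|t - th0| <= s ->
    `|col_mx t (xs th - gamma *: H (col_mx t (xs th))) - col_mx th0 w0| < r2.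
  move=> ts; have hx := near_x t ts; have hxr := le_lt_trans hx h1.
  apply: le_lt_trans (norm_col_mx_sub _ _ _ _) _; apply: le_lt_trans h4.
  apply: le_trans (lerD ts (w_dist _ _ hxr)) _.
  have k1 : gamma * K1 * `|col_mx t (xs th) - col_mx th0 x0| <= gamma * K1 * ((1 + C) * s).
    by rewrite ler_wpM2l.
  have k2 : `|xs th - x0| <= C * s.
    by apply: le_trans (center _ Tth the) _; rewrite ler_wpM2l// le_max lexx.
  rewrite mulrDl mul1r; lra.
have t1 : `|th - th0| <= s by rewrite le_max lexx.
have t2 : `|th' - th0| <= s by rewrite le_max lexx orbT.
rewrite (le_trans (HK _ _ Tth Tth'))// /C -!mulrA ler_wpM2l// wE; apply: step.
- exact: le_lt_trans (near_x _ t1) h1.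
- exact: le_lt_trans (near_x _ t2) h1.
- exact: near_w.
- exact: near_w.
Qed.

Let solution_cvg th (ths : nat -> 'cV[R]_p) : Theta th -> ths @ \oo --> th ->
  (fun k => col_mx (ths k) (xs (ths k))) @ \oo --> col_mx th (xs th) /\
  (fun k => col_mx (ths k) (w (ths k))) @ \oo --> col_mx th (w th).
Proof.
move=> Tth thsC; have [lH _] := pH.
have xC : (fun k => xs (ths k)) @ \oo --> xs th.
  exact: (loc_lipschitz_cvg oTheta fixed_point_loc_lipschitz Tth thsC).
have PC : (fun k => col_mx (ths k) (xs (ths k))) @ \oo --> col_mx th (xs th).
  exact: cvg_col_mx.
split => //; apply: cvg_col_mx => //; under eq_fun do rewrite wE.
rewrite wE; apply: cvgB => //; apply: cvgZr.
exact: (loc_lipschitz_cvg oD lH (Dcol _ Tth) PC).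
Qed.

Let clarke_bound th : Theta th -> exists d K : R, [/\ 0 < d, 0 <= K &
  forall th' A B, Theta th' -> `|th' - th| < d ->
    clarke_jac T (col_mx th' (w th')) A -> clarke_jac H (col_mx th' (xs th')) B ->
    `|A| <= K /\ `|B| <= K].
Proof.
move=> Tth.
have [_ [/(_ _ (Dcol (w th) Tth))[e1 [K1 [e10 HK1]]] _]] := clarke_conservative oD pT.
have [_ [/(_ _ (Dcol (xs th) Tth))[e2 [K2 [e20 HK2]]] _]] := clarke_conservative oD pH.
have [|d1 [d10 Hd1]] := @seq_continuous_eps R _ _ Theta (fun t => col_mx t (w t)) th _ e1 e10.
  by move=> u _ uC; case: (solution_cvg Tth uC).
have [|d2 [d20 Hd2]] := @seq_continuous_eps R _ _ Theta (fun t => col_mx t (xs t)) th _ e2 e20.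
  by move=> u _ uC; case: (solution_cvg Tth uC).
exists (Num.min d1 d2), (Num.max `|K1| `|K2|); split.
- by rewrite lt_min d10.
- by rewrite le_max normr_ge0.
move=> th' A B Tth'; rewrite lt_min => /andP[/(Hd1 _ Tth') h1 /(Hd2 _ Tth') h2] HA HB.
split; rewrite le_max.
- rewrite (le_trans _ (ler_norm K1))//; apply: HK1 HA; first exact: Dcol.
  by rewrite -ball_normE/= distrC.
- rewrite [X in _ || X](le_trans _ (ler_norm K2)) ?orbT//; apply: HK2 HB; first exact: Dcol.
  by rewrite -ball_normE/= distrC.
Qed.

Lemma fixed_point_conservative : conservative_on Theta xs Jxs.
Proof.
have cT := clarke_conservative oD pT; have cH := clarke_conservative oD pH.
have [neT [_ [clT cuT]]] := cT; have [neH [_ [clH cuH]]] := cH.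
split; last split; last split.
- move=> th Tth; have [A HA] := neT _ (Dcol (w th) Tth).
  have [B HB] := neH _ (Dcol (xs th) Tth).
  exists (invmx (resolvent A B) *m rhs A B); apply/JxsP => //; exists A, B; split => //.
  by rewrite mulKVmx//; exact: resolvent_unit HA HB.
- move=> th Tth; have [d [K [d0 K0 HK]]] := clarke_bound Tth.
  have [L [L0 HL]] := absorb.
  pose C := K + gamma * (n%:R * (K * K)).
  have C0 : 0 <= C by rewrite addr_ge0// !mulr_ge0// ltW.
  exists d, (L * (p%:R * C)); split => // th' M Tth'.
  rewrite -ball_normE/= distrC => thd /(JxsP _ Tth')[A [B [HA HB E]]].
  have [KA KB] := HK _ _ _ Tth' thd HA HB.
  apply: mx_norm_le_mulmx => [|v]; first by rewrite !mulr_ge0.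
  (* [M *m v] equals its contracted image plus [rhs A B *m v], so the contracted term can be
     absorbed. *)
  have dE : M *m v = rsubmx A *m ((1%:M - gamma *: rsubmx B) *m (M *m v)) + rhs A B *m v.
    have split_id (V X : 'M[R]_n) (u : 'cV_n) : u = V *m (X *m u) + (1%:M - V *m X) *m u.
      by rewrite mulmxBl mul1mx mulmxA addrC subrK.
    by rewrite -E -(mulmxA (resolvent A B)); exact: split_id.
  have := HL _ _ _ dE (clarke_contraction (M *m v) Tth' HA HB).
  move=> /le_trans; apply; rewrite -!mulrA ler_wpM2l//.
  apply: le_trans (ler_norm_mulmx _ _) _; rewrite ler_wpM2l// ler_wpM2r//.
  rewrite /rhs (le_trans (ler_normB _ _))// lerD//.
    exact: le_trans (norm_lsubmx_le _) KA.
  rewrite normrZ gtr0_norm// ler_wpM2l ?(ltW gamma0)//.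
  apply: le_trans (ler_norm_mulmx _ _) _; rewrite ler_wpM2l// ler_pM//.
    exact: le_trans (norm_rsubmx_le _) KA.
  exact: le_trans (norm_lsubmx_le _) KB.
- move=> ths Ms th M Dths HM Tth thsC MsC.
  have [d [K [d0 K0 HK]]] := clarke_bound Tth.
  have d20 : 0 < d / 2 by rewrite divr_gt0.
  have /cvg_seqP/(_ _ d20)[k0 Hk0] := thsC.
  have /choice[AB HAB] : forall k, exists AB : 'M[R]_(n, p + n) * 'M[R]_(n, p + n),
      let th' := ths (k + k0)%N in
      [/\ clarke_jac T (col_mx th' (w th')) AB.1, clarke_jac H (col_mx th' (xs th')) AB.2 &
        resolvent AB.1 AB.2 *m Ms (k + k0)%N = rhs AB.1 AB.2].
    move=> k; have /(JxsP _ (Dths _))[A [B HAB]] := HM (k + k0)%N.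
    by exists (A, B).
  have bnd k : `|(AB k).1| <= K /\ `|(AB k).2| <= K.
    have [HA HB _] := HAB k; apply: HK HA HB => //.
    apply: le_lt_trans (Hk0 _ (leq_addl _ _)) _.
    by rewrite ltr_pdivrMr// ltr_pMr// ltr1n.
  have [|s1 [s1i [A AC]]] := @bounded_mx_subseq R _ _ (fun k => (AB k).1) K.
    by move=> k; case: (bnd k).
  have [|s2 [s2i [B BC]]] := @bounded_mx_subseq R _ _ (fun k => (AB (s1 k)).2) K.
    by move=> k; case: (bnd (s1 k)).
  have {}AC : (fun k => (AB (s1 (s2 k))).1) @ \oo --> A.
    exact: (cvg_subseq s2i AC).
  have si : increasing_seq (s1 \o s2) by exact: increasing_seq_comp.
  have tC : (fun k => ths (s1 (s2 k) + k0)%N) @ \oo --> th.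
    apply: (@cvg_subseq _ _ (fun k => ths (k + k0)%N) _ _ si).
    by rewrite (cvg_shiftn k0 ths).
  have MC : (fun k => Ms (s1 (s2 k) + k0)%N) @ \oo --> M.
    apply: (@cvg_subseq _ _ (fun k => Ms (k + k0)%N) _ _ si).
    by rewrite (cvg_shiftn k0 Ms).
  have [PC QC] := solution_cvg Tth tC.
  apply/JxsP => //; exists A, B; split.
  + apply: (clT _ _ _ _ _ _ (Dcol _ Tth) QC AC) => k; first exact: Dcol.
    by case: (HAB (s1 (s2 k))).
  + apply: (clH _ _ _ _ _ _ (Dcol _ Tth) PC BC) => k; first exact: Dcol.
    by case: (HAB (s1 (s2 k))).
  + have rC : (fun k => resolvent (AB (s1 (s2 k))).1 (AB (s1 (s2 k))).2 *m
        Ms (s1 (s2 k) + k0)%N) @ \oo --> resolvent A B *m M.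
      apply: cvg_mulmx => //; apply: cvgB; first exact: cvg_cst.
      apply: cvg_mulmx; first exact: cvg_rsubmx.
      by apply: cvgB; [exact: cvg_cst|apply: cvgZr; exact: cvg_rsubmx].
    apply: (cvg_unique_seq rC).
    rewrite (_ : (fun _ => _) = (fun k => rhs (AB (s1 (s2 k))).1 (AB (s1 (s2 k))).2)).
      apply: cvgB; first exact: cvg_lsubmx.
      by apply: cvgZr; apply: cvg_mulmx; [exact: cvg_rsubmx|exact: cvg_lsubmx].
    by apply/funext => k; case: (HAB (s1 (s2 k))).
- move=> c ac cTh.
  (* Conservativity of the Clarke Jacobians is applied along these lifted curves. As the solution is
     a block of [c1], its derivability at almost every time is part of what is obtained. *)
  pose c1 t := col_mx (c t) (xs (c t)).
  pose c2 t := col_mx (c t) (w (c t)).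
  have D1 t : 0 <= t <= 1 -> D (c1 t) by move=> t01; apply: Dcol; exact: cTh.
  have D2 t : 0 <= t <= 1 -> D (c2 t) by move=> t01; apply: Dcol; exact: cTh.
  have acx : abs_cont_curve 0 1 (xs \o c).
    exact: abs_cont_comp oTheta fixed_point_loc_lipschitz ac cTh.
  have ac1 : abs_cont_curve 0 1 c1.
    apply: (abs_cont_dominated ler01 ac acx) => s t _ _.
    by rewrite mul1r; exact: norm_col_mx_sub.
  have acH : abs_cont_curve 0 1 (H \o c1).
    by apply: abs_cont_comp oD _ ac1 D1; case: pH.
  have acw : abs_cont_curve 0 1 (w \o c).
    apply: (abs_cont_dominated (ltW gamma0) acx acH) => s t _ _ /=.
    have -> : w (c s) - w (c t) = (xs (c s) - xs (c t)) - gamma *: (H (c1 s) - H (c1 t)).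
      by rewrite !wE; apply/matrixP => i j; rewrite !mxE; ring.
    by rewrite (le_trans (ler_normB _ _))// lerD2l normrZ gtr0_norm.
  have ac2 : abs_cont_curve 0 1 c2.
    apply: (abs_cont_dominated ler01 ac acw) => s t _ _.
    by rewrite mul1r; exact: norm_col_mx_sub.
  have n1 := cuT c2 ac2 D2; have n2 := cuH c1 ac1 D1.
  (* The endpoints are discarded: [xs \o c] and [T \o c2] are known to agree only on [[0, 1]], which
     compares two-sided derivatives at interior times. *)
  have n3 := negligibleU (negligibleU n1 n2)
    (negligibleU (negligible_set1 0) (negligible_set1 1)).
  apply: negligibleS n3 => t nt; apply: contrapT => ok; apply: nt => t01.
  have Tt : `[0, 1]%classic t -> (derivable c2 t 1 /\ derivable (T \o c2) t 1 /\
      forall M, clarke_jac T (c2 t) M -> derive1 (T \o c2) t = M *m derive1 c2 t).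
    by apply: contrapT => h; apply: ok; left; left.
  have Ht : `[0, 1]%classic t -> (derivable c1 t 1 /\ derivable (H \o c1) t 1 /\
      forall M, clarke_jac H (c1 t) M -> derive1 (H \o c1) t = M *m derive1 c1 t).
    by apply: contrapT => h; apply: ok; left; right.
  have t01' : 0 < t < 1.
    move: t01; rewrite /= in_itv/= !le_eqVlt => /andP[/orP[/eqP t0|->] /orP[/eqP t1|->]] //.
    - by exfalso; apply: ok; right; left.
    - by exfalso; apply: ok; right; left.
    - by exfalso; apply: ok; right; right.
  have [dc2 [dT HT]] := Tt t01; have [dc1 [dH HH]] := Ht t01.
  have [dc cE] := derive1_usubmx dc1; have [dx xE] := derive1_dsubmx dc1.
  have [_ cE2] := derive1_usubmx dc2; have [_ wE2] := derive1_dsubmx dc2.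
  rewrite (_ : (fun s => usubmx (c1 s)) = c) in dc cE; last first.
    by apply/funext => s; rewrite /c1 col_mxKu.
  rewrite (_ : (fun s => dsubmx (c1 s)) = xs \o c) in dx xE; last first.
    by apply/funext => s; rewrite /c1 col_mxKd.
  rewrite (_ : (fun s => usubmx (c2 s)) = c) in cE2; last first.
    by apply/funext => s; rewrite /c2 col_mxKu.
  rewrite (_ : (fun s => dsubmx (c2 s)) = (xs \o c) - (gamma \*: (H \o c1))) in wE2; last first.
    by apply/funext => s; rewrite /c2 col_mxKd wE.
  have [_ TE] : derivable (xs \o c) t 1 /\ derive1 (xs \o c) t = derive1 (T \o c2) t.
    apply: derive1_eq_unit_interval => // s s01 /=.
    by rewrite /c2 xsE//; exact: cTh.
  split => //; split => // M HM.
  have Tct : Theta (c t) by apply: cTh; move: t01; rewrite /= in_itv.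
  have /(JxsP _ Tct)[A [B [HA HB E]]] := HM.
  have uAB := resolvent_unit Tct HA HB.
  have hA := HT A HA; have hB := HH B HB.
  apply: (can_inj (mulKmx uAB)); rewrite mulmxA E.
  set c' := derive1 c t in cE cE2 *; set x' := derive1 (xs \o c) t in xE TE *.
  have w' : dsubmx (derive1 c2 t) = x' - gamma *: (B *m derive1 c1 t).
    have E1 := deriveB dx (derivableZ (k := gamma) dH).
    have E2 := deriveZ gamma dH.
    by rewrite -wE2 -hB derive1E E1 E2 /x' !derive1E.
  have x'E : x' = A *m derive1 c2 t by rewrite TE.
  rewrite -[A]hsubmxK -[derive1 c2 t]vsubmxK mul_row_col -cE2 w' in x'E.
  rewrite -[B]hsubmxK -[derive1 c1 t]vsubmxK mul_row_col -cE -xE in x'E.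
  by rewrite (resolvent_eq x'E).
Qed.

End ImplicitFixedPoint.

(** * The forward-backward map of the parametrised minimization problem *)

Theorem theorem3 (R : realType) (p n : nat) (Theta : set 'cV[R]_p)
    (F : 'cV[R]_p -> 'cV[R]_n -> R) (G : 'cV[R]_p -> 'cV[R]_n -> \bar R)
    (alpha beta : R) (T : 'cV[R]_(p + n) -> 'cV[R]_n) :
  open Theta -> connected Theta -> Theta !=set0 ->
  0 < alpha -> 0 < beta ->
  (* f_theta convex, C^1, beta-Lipschitz gradient *)
  (forall th, Theta th -> convex_fun (F th)) ->
  (forall th x, Theta th -> differentiable (F th) x) ->
  (forall th, Theta th -> continuous (gradient (F th))) ->
  (forall th x y, Theta th ->
     enorm (gradient (F th) x - gradient (F th) y) <= beta * enorm (x - y)) ->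
  (* g_theta closed convex proper *)
  (forall th, Theta th -> closed_fun (G th)) ->
  (forall th, Theta th -> econvex_fun (G th)) ->
  (forall th, Theta th -> proper_fun (G th)) ->
  (* strong convexity of all f_theta or of all g_theta *)
  ((forall th, Theta th -> strongly_convex_fun alpha (F th)) \/
   (forall th, Theta th -> estrongly_convex_fun alpha (G th))) ->
  let gamma := alpha / (alpha + beta) ^+ 2 in
  (* T (theta, x) = prox_{gamma g_theta} (x) on Theta x R^n *)
  (forall th x, Theta th ->
     is_prox (fun u => (gamma%:E * G th u)%E) x (T (col_mx th x))) ->
  path_diff_on [set z : 'cV[R]_(p + n) | Theta (usubmx z)] T ->
  path_diff_on [set z : 'cV[R]_(p + n) | Theta (usubmx z)] (joint_grad F) ->
  (forall th, Theta th -> exists! x, is_minimizer (F th) (G th) x) /\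
  exists xs : 'cV[R]_p -> 'cV[R]_n,
    (forall th, Theta th -> is_minimizer (F th) (G th) (xs th)) /\
    (forall th (U : 'M[R]_(n, p)) (V : 'M[R]_n) (W : 'M[R]_(n, p)) (Z : 'M[R]_n),
       Theta th ->
       clarke_jac T (col_mx th (xs th - gamma *: gradient (F th) (xs th))) (row_mx U V) ->
       clarke_jac (joint_grad F) (col_mx th (xs th)) (row_mx W Z) ->
       (1%:M - V *m (1%:M - gamma *: Z)) \in unitmx) /\
    loc_lipschitz_on Theta xs /\
    conservative_on Theta xs
      (fun th => [set M : 'M[R]_(n, p) | exists (U : 'M[R]_(n, p)) (V : 'M[R]_n)
                    (W : 'M[R]_(n, p)) (Z : 'M[R]_n),
         clarke_jac T (col_mx th (xs th - gamma *: gradient (F th) (xs th))) (row_mx U V) /\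
         clarke_jac (joint_grad F) (col_mx th (xs th)) (row_mx W Z) /\
         M = invmx (1%:M - V *m (1%:M - gamma *: Z)) *m (U - gamma *: (V *m W))]).
Proof.
move=> oTh _ _ al0 be0 cF dF _ LF _ cG pG SC gamma Tprox pT pH.
have ab0 : 0 < alpha + beta by rewrite addr_gt0.
have g0 : 0 < gamma by rewrite divr_gt0// exprn_gt0.
have gE : gamma * (alpha + beta) ^+ 2 = alpha by rewrite divfK// gt_eqF// exprn_gt0.
clearbody gamma.
(* [mu] and [nu] are the moduli of [g] and [f]; the two alternatives then share one proof up to the
   numerical check of [ab1]. *)
have [mu [nu [munu cFn cGm]]] : exists mu nu : R,
    [/\ (mu = 0 /\ nu = alpha) \/ (mu = alpha /\ nu = 0),
      forall th, Theta th -> modconvex nu (F th) &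
      forall th, Theta th -> emodconvex mu (G th)].
  case: SC => S; [exists 0, alpha|exists alpha, 0]; split; [by left| | |by right| |] => th Tth.
  - exact: strongly_convex_modconvex (S th Tth).
  - exact: econvex_emodconvex (cG th Tth).
  - exact: convex_modconvex (cF th Tth).
  - exact: estrongly_convex_emodconvex (S th Tth).
have mu0 : 0 <= mu by case: munu => -[-> _] //; exact: ltW.
have mn0 : 0 < mu + nu by case: munu => -[-> ->]; rewrite ?add0r ?addr0.
pose a := ((1 + gamma * mu) ^+ 2)^-1.
pose b := (1 - gamma * nu) ^+ 2 + (gamma * beta) ^+ 2.
have s0 : 0 < 1 + gamma * mu by rewrite ltr_pwDl// mulr_ge0// ltW.
have a0 : 0 <= a by rewrite invr_ge0 exprn_ge0// ltW.
have b0 : 0 <= b by rewrite addr_ge0// sqr_ge0.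
(* By [k2] and [k3], [gamma^2 * (alpha^2 + beta^2) <= gamma * alpha], which settles both cases. *)
have ab1 : a * b < 1.
  rewrite mulrC ltr_pdivrMr ?exprn_gt0// mul1r /b.
  have k1 : 0 < gamma * alpha by rewrite mulr_gt0.
  have k2 : 0 <= gamma * (gamma * (2 * alpha * beta)) by apply: ltW; rewrite !mulr_gt0.
  have k3 : gamma * (gamma * (alpha + beta) ^+ 2) = gamma * alpha by rewrite gE.
  have k4 : 0 <= (gamma * alpha) ^+ 2 by rewrite sqr_ge0.
  by case: munu => -[-> ->]; lra.
have HE th x : joint_grad F (col_mx th x) = gradient (F th) x.
  by rewrite /joint_grad col_mxKu col_mxKd.
have T_contr th x y : Theta th ->
    enorm2 (T (col_mx th x) - T (col_mx th y)) <= a * enorm2 (x - y).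
  move=> Tth; apply: (prox_contraction g0 mu0 (pG th Tth) (cGm th Tth)); exact: Tprox.
have grad_contr th x y : Theta th ->
    enorm2 ((x - gamma *: gradient (F th) x) - (y - gamma *: gradient (F th) y)) <=
    b * enorm2 (x - y).
  move=> Tth; apply: gradient_step_contraction (ltW g0) (ltW be0) (cFn th Tth) _ _.
    by move=> z; exact: dF.
  exact: LF.
have /choice[xs xsE] : forall th, exists x,
    Theta th -> T (col_mx th (x - gamma *: gradient (F th) x)) = x.
  (* Outside [Theta] the value 0 is a default, as [choice] produces a total function. *)
  move=> th; have [Tth|nT] := pselect (Theta th); last by exists 0.
  have ab01 : 0 <= a * b < 1 by rewrite mulr_ge0.
  have [|x xE] := @contraction_fixed_point R n (a * b)
    (fun x => T (col_mx th (x - gamma *: gradient (F th) x))) ab01; last by exists x.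
  move=> x y; apply: le_trans (T_contr _ _ _ Tth) _.
  by rewrite -mulrA ler_wpM2l// grad_contr.
pose w th := xs th - gamma *: gradient (F th) (xs th).
have wE th : w th = xs th - gamma *: joint_grad F (col_mx th (xs th)) by rewrite HE.
have H_contr th x y : Theta th ->
    enorm2 ((x - gamma *: joint_grad F (col_mx th x)) -
            (y - gamma *: joint_grad F (col_mx th y))) <= b * enorm2 (x - y).
  by move=> Tth; rewrite !HE; exact: grad_contr.
have cF0 th : Theta th -> modconvex 0 (F th).
  by move=> Tth; exact: convex_modconvex (cF th Tth).
have xs_min th : Theta th -> is_minimizer (F th) (G th) (xs th).
  move=> Tth; apply: (fixed_point_minimizer g0 mu0 (cF0 th Tth) _ (pG th Tth) (cGm th Tth)).
    by move=> z; exact: dF.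
  by have := Tprox th (w th) Tth; rewrite xsE.
split.
  move=> th Tth; exists (xs th); split; first exact: xs_min.
  move=> y; apply: (minimizer_unique mn0 (cFn th Tth) _ (pG th Tth) (cGm th Tth)).
    by move=> z; exact: dF.
  exact: xs_min.
exists xs; split => //; split; last split.
- move=> th U V W Z Tth HT HH.
  have := @resolvent_unit R p n Theta T (joint_grad F) gamma a b xs w oTh a0 ab1
    T_contr H_contr th (row_mx U V) (row_mx W Z) Tth HT HH.
  by rewrite !row_mxKr.
- exact: (fixed_point_loc_lipschitz oTh g0 a0 b0 ab1 T_contr H_contr pT pH wE xsE).
- exact: (fixed_point_conservative oTh g0 a0 b0 ab1 T_contr H_contr pT pH wE xsE).
Qed.
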